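(* If $N$ is a real hypersurface of a complex space form $\tilde M^{h+1}(4c)$, then the Ricci tensor $Ric$ of $N$ satisfies $$Ric(J\xi,J\xi)\leq \frac{(2h+1)^2}{2}H^2+2hc,$$ where $\xi$ is a unit normal vector field of $N$ in $\tilde M^{h+1}(4c)$. The equality sign holds identically if and only if $N$ is a minimal special Hopf hypersurface.
   Context: $\tilde M^m(4c)$ denotes a complete, simply-connected complex space form of complex dimension $m$, i.e. a Kähler manifold (complex structure $J$, metric $\langle\,,\rangle$) of constant holomorphic sectional curvature $4c$; it is $CP^m(4c)$, $\mathbf C^m$ or $CH^m(4c)$ according to $c>0$, $c=0$, $c<0$. Here $h\ge 1$ is an integer. A real hypersurface $N$ of $\tilde M^{h+1}(4c)$ has real dimension $n=2h+1$. $\sigma$ is its second fundamental form, $A_\xi$ its shape operator, $\langle A_\xi X,Y\rangle=\langle\sigma(X,Y),\xi\rangle$; $\overrightarrow H=\frac1n\,\mathrm{trace}\,\sigma$ is the mean curvature vector, and $H^2=\langle\overrightarrow H,\overrightarrow H\rangle$. $N$ is minimal if $\overrightarrow H=0$ identically. $N$ is a Hopf hypersurface if $J\xi$ is an eigenvector of $A_\xi$; a Hopf hypersurface is special if the eigenvalue is $0$, i.e. $A_\xi(J\xi)=0$. *)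

(* Defs.v *)
From HB Require Import structures.
From mathcomp Require Import all_boot all_order all_algebra.
From mathcomp Require Import all_classical all_reals all_analysis.

Set Implicit Arguments.
Unset Strict Implicit.
Unset Printing Implicit Defensive.

Import Order.TTheory GRing.Theory Num.Theory.
Import numFieldNormedType.Exports.

Local Open Scope classical_set_scope.
Local Open Scope ring_scope.

(* Differential geometry in coordinates.  Tangent vectors are row vectors of
   components, so that linear maps act on the right: df(X) = X *m 'J F x, and
   the rows of the matrix of an endomorphism are the images of the coordinate
   vector fields d_i. *)

Section LocalGeometry.
Context {R : realType}.
Implicit Types (n m : nat).

Definition pd n (V : normedModType R) (i : 'I_n) (F : 'rV[R]_n -> V)
  (x : 'rV[R]_n) : V := 'D_(delta_mx 0 i) F x.

(* C^oo on an open set U: every iterated partial derivative is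
   differentiable at every point of U. *)
Definition smooth_on n (V : normedModType R) (U : set 'rV[R]_n)
  (F : 'rV[R]_n -> V) : Prop :=
  forall (s : seq 'I_n) x, U x -> differentiable (foldr (@pd n V) F s) x.

Definition inner n (g : 'M[R]_n) (u v : 'rV[R]_n) : R := (u *m g *m v^T) 0 0.

(* Levi-Civita connection of the metric G: row i of [christoffel G k x] holds
   the components of nabla_{d_k} d_i, obtained by solving
   <nabla_{d_k} d_i, d_l> = (d_k g_il + d_i g_kl - d_l g_ki) / 2. *)
Definition christoffel n (G : 'rV[R]_n -> 'M[R]_n) (k : 'I_n)
  (x : 'rV[R]_n) : 'M[R]_n :=
  (\matrix_(i, l) ((pd k G x i l + pd i G x k l - pd l G x k i) / 2))
    *m invmx (G x).

(* The zeroth order term u^a w^i Gamma_{a i} of nabla_u w. *)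
Definition connection_term n (G : 'rV[R]_n -> 'M[R]_n) (x u w : 'rV[R]_n) :
  'rV[R]_n := \sum_a u 0 a *: (w *m christoffel G a x).

(* Row k holds the components of R(d_i, d_j) d_k, with
   R(X, Y) = [nabla_X, nabla_Y] - nabla_[X, Y]. *)
Definition curvature_mx n (G : 'rV[R]_n -> 'M[R]_n) (i j : 'I_n)
  (x : 'rV[R]_n) : 'M[R]_n :=
  pd i (christoffel G j) x - pd j (christoffel G i) x
  + christoffel G j x *m christoffel G i x
  - christoffel G i x *m christoffel G j x.

Definition curvature n (G : 'rV[R]_n -> 'M[R]_n) (x X Y Z : 'rV[R]_n) :
  'rV[R]_n :=
  \sum_i \sum_j (X 0 i * Y 0 j) *: (Z *m curvature_mx G i j x).

Definition sectional n (G : 'rV[R]_n -> 'M[R]_n) (x X Y : 'rV[R]_n) : R :=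
  inner (G x) (curvature G x X Y Y) X /
  (inner (G x) X X * inner (G x) Y Y - inner (G x) X Y ^+ 2).

Definition ricci n (G : 'rV[R]_n -> 'M[R]_n) (x Y Z : 'rV[R]_n) : R :=
  \tr (lin1_mx (fun X => curvature G x X Y Z)).

(* Gauss formula: sigma(d_i, d_j) is the derivative of dF(d_j) along d_i in
   the ambient space (metric G') minus dF(nabla_{d_i} d_j), nabla being the
   Levi-Civita connection of the metric G of the submanifold. *)
Definition sff_coord n m (G : 'rV[R]_n -> 'M[R]_n) (G' : 'rV[R]_m -> 'M[R]_m)
  (F : 'rV[R]_n -> 'rV[R]_m) (i j : 'I_n) (x : 'rV[R]_n) : 'rV[R]_m :=
  pd i (pd j F) x + connection_term G' (F x) (pd i F x) (pd j F x)
  - row j (christoffel G i x) *m 'J F x.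

End LocalGeometry.

Section Manifolds.
Context {R : realType}.
Implicit Types (n m : nat).

Record chart (M : topologicalType) n := Chart {
  cdom : set M ;
  cmap :> M -> 'rV[R]_n ;
  cinv : 'rV[R]_n -> M ;
  cdom_open : open cdom ;
  cimg_open : open (cmap @` cdom) ;
  cmapK : forall p, cdom p -> cinv (cmap p) = p ;
  cmap_continuous : {within cdom, continuous cmap} ;
  cinv_continuous : {within cmap @` cdom, continuous cinv} }.

Record manifold n := Manifold {
  carrier :> topologicalType ;
  carrier_hausdorff : hausdorff_space carrier ;
  carrier_countable : @second_countable carrier ;
  atlas : set (chart carrier n) ;
  chart_at : carrier -> chart carrier n ;
  chart_at_atlas : forall p, atlas (chart_at p) ;
  chart_at_dom : forall p, cdom (chart_at p) p ;
  transition_smooth : forall a b, atlas a -> atlas b ->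
    smooth_on (a @` (cdom a `&` cdom b)) (b \o cinv a) }.

(* Tangent vectors at p are given by their components in [chart_at p]. *)
Definition tangent n (M : manifold n) (p : M) : Type := 'rV[R]_n.

Record riemannian n := Riemannian {
  rmanifold :> manifold n ;
  metric : chart rmanifold n -> 'rV[R]_n -> 'M[R]_n ;
  metric_smooth : forall a, atlas a -> smooth_on (a @` cdom a) (metric a) ;
  metric_sym : forall a, atlas a -> forall p, cdom a p ->
    (metric a (a p))^T = metric a (a p) ;
  metric_pos : forall a, atlas a -> forall p, cdom a p ->
    forall u, u != 0 -> 0 < inner (metric a (a p)) u u ;
  metric_change : forall a b, atlas a -> atlas b ->
    forall p, cdom a p -> cdom b p ->
    let D := 'J (b \o cinv a) (a p) in
    metric a (a p) = D *m metric b (b p) *m D^T }.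

Definition metric_at n (M : riemannian n) (p : M) : 'M[R]_n :=
  metric (chart_at p) (chart_at p p).

Definition dotp n (M : riemannian n) (p : M) (u v : tangent p) : R :=
  inner (metric_at p) u v.

Definition sectional_at n (M : riemannian n) (p : M) (X Y : tangent p) : R :=
  sectional (metric (chart_at p)) (chart_at p p) X Y.

Definition Ric n (M : riemannian n) (p : M) (Y Z : tangent p) : R :=
  ricci (metric (chart_at p)) (chart_at p p) Y Z.

Definition geodesic n (M : riemannian n) (gamma : R -> M) : Prop :=
  continuous gamma /\
  forall (a : chart M n) (t : R), atlas a -> cdom a (gamma t) ->
    let x : R -> 'rV[R]_n := a \o gamma in
    let x' := derive1 x in
    [/\ derivable x t 1, derivable x' t 1 &
        derive1 x' t + connection_term (metric a) (x t) (x' t) (x' t) = 0].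

(* Geodesic completeness. *)
Definition complete n (M : riemannian n) : Prop :=
  forall (p : M) (v : tangent p), exists gamma : R -> M,
    [/\ geodesic gamma, gamma 0 = p &
        derive1 ((chart_at p : M -> 'rV[R]_n) \o gamma) 0 = v].

Definition simply_connected (T : topologicalType) : Prop :=
  (exists p : T, True) /\
  (forall p q : T, exists gamma : R -> T,
     [/\ {within `[0, 1]%classic, continuous gamma}, gamma 0 = p & gamma 1 = q]) /\
  (forall gamma : R -> T,
     {within `[0, 1]%classic, continuous gamma} -> gamma 0 = gamma 1 ->
     exists K : R * R -> T,
       [/\ {within `[0, 1]%classic `*` `[0, 1]%classic, continuous K},
           (forall t, `[0, 1]%classic t -> K (0, t) = gamma t),
           (forall t, `[0, 1]%classic t -> K (1, t) = gamma 0) &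
           (forall s, `[0, 1]%classic s -> K (s, 0) = gamma 0 /\ K (s, 1) = gamma 0)]).

(* Kaehler manifold of complex dimension m: an orthogonal almost complex
   structure J, acting by u |-> u *m cplx a x in the chart a, with nabla J = 0
   (which entails integrability). *)
Record kahler m := Kahler {
  kriemannian :> riemannian m.*2 ;
  cplx : chart kriemannian m.*2 -> 'rV[R]_m.*2 -> 'M[R]_m.*2 ;
  cplx_smooth : forall a, atlas a -> smooth_on (a @` cdom a) (cplx a) ;
  cplx_change : forall a b, atlas a -> atlas b ->
    forall p, cdom a p -> cdom b p ->
    let D := 'J (b \o cinv a) (a p) in
    cplx a (a p) *m D = D *m cplx b (b p) ;
  cplx_sqr : forall a, atlas a -> forall p, cdom a p ->
    cplx a (a p) *m cplx a (a p) = - 1%:M ;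
  cplx_orthogonal : forall a, atlas a -> forall p, cdom a p ->
    cplx a (a p) *m metric a (a p) *m (cplx a (a p))^T = metric a (a p) ;
  cplx_parallel : forall a, atlas a -> forall p, cdom a p -> forall k,
    pd k (cplx a) (a p) + cplx a (a p) *m christoffel (metric a) k (a p)
    - christoffel (metric a) k (a p) *m cplx a (a p) = 0 }.

Definition Jmap m (M : kahler m) (p : M) (u : tangent p) : tangent p :=
  u *m cplx (chart_at p) (chart_at p p).

Definition constant_holomorphic_curvature m (M : kahler m) (k : R) : Prop :=
  forall (p : M) (X : tangent p), X <> 0 :> 'rV[R]_m.*2 ->
    sectional_at X (Jmap X) = k.

Definition complex_space_form m (M : kahler m) (k : R) : Prop :=
  [/\ complete M, simply_connected M & constant_holomorphic_curvature M k].

(* Smooth map with f^* g_M = g_N; as g_N is positive definite this forces f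
   to be an immersion. *)
Definition isometric_immersion n m (N : riemannian n) (M : riemannian m)
  (f : N -> M) : Prop :=
  continuous f /\
  forall (a : chart N n) (b : chart M m), atlas a -> atlas b ->
    let F : 'rV[R]_n -> 'rV[R]_m := b \o f \o cinv a in
    smooth_on (a @` (cdom a `&` f @^-1` cdom b)) F /\
    forall p, cdom a p -> cdom b (f p) ->
      metric a (a p) = 'J F (a p) *m metric b (b (f p)) *m ('J F (a p))^T.

Section Submanifolds.
Variables (n m : nat) (N : riemannian n) (M : riemannian m) (f : N -> M).
Implicit Types (p : N).

Definition local_expr p : 'rV[R]_n -> 'rV[R]_m :=
  chart_at (f p) \o f \o cinv (chart_at p).

Definition differential p (X : tangent p) : tangent (f p) :=
  X *m 'J (local_expr p) (chart_at p p).

(* The adjoint of the differential, <tangential v, X> = <v, df X>: when f is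
   isometric, df (tangential v) is the orthogonal projection of v on
   df (T_p N), so that [tangential v] is v itself, seen in T_p N, when v is
   tangent to N. *)
Definition tangential p (v : tangent (f p)) : tangent p :=
  v *m metric_at (f p) *m ('J (local_expr p) (chart_at p p))^T
    *m invmx (metric_at p).

Definition sff_basis p (i j : 'I_n) : tangent (f p) :=
  sff_coord (metric (chart_at p)) (metric (chart_at (f p)))
    (local_expr p) i j (chart_at p p).

Definition sff p (X Y : tangent p) : tangent (f p) :=
  \sum_i \sum_j ((X : 'rV[R]_n) 0 i * (Y : 'rV[R]_n) 0 j) *:
    (sff_basis p i j : 'rV[R]_m).

(* (1/n) g^ij sigma(d_i, d_j) *)
Definition mean_curvature p : tangent (f p) :=
  n%:R^-1 *: (\sum_i \sum_j invmx (metric_at p) i j *: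
    (sff_basis p i j : 'rV[R]_m)).

Definition mean_curvature_sqr p : R :=
  dotp (mean_curvature p) (mean_curvature p).

Definition minimal : Prop := forall p, mean_curvature p = 0 :> 'rV[R]_m.

Definition unit_normal p (xi : tangent (f p)) : Prop :=
  dotp xi xi = 1 /\ forall X : tangent p, dotp xi (differential X) = 0.

(* A_xi X is the vector determined by <A_xi X, Y> = <sigma(X, Y), xi>. *)
Definition shape p (xi : tangent (f p)) (X : tangent p) : tangent p :=
  (\row_j dotp (sff X (delta_mx 0 j : 'rV[R]_n)) xi) *m invmx (metric_at p).

End Submanifolds.

Section Hypersurfaces.
Variables (n m : nat) (N : riemannian n) (M : kahler m) (f : N -> M).

(* J xi as a tangent vector of N. *)
Definition Jnormal (p : N) (xi : tangent (f p)) : tangent p :=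
  tangential (Jmap xi).

Definition hopf : Prop :=
  forall (p : N) (xi : tangent (f p)), unit_normal xi ->
    exists lambda : R,
      shape xi (Jnormal xi) = lambda *: (Jnormal xi : 'rV[R]_n) :> 'rV[R]_n.

Definition special_hopf : Prop :=
  hopf /\ forall (p : N) (xi : tangent (f p)), unit_normal xi ->
    shape xi (Jnormal xi) = 0 :> 'rV[R]_n.

End Hypersurfaces.

End Manifolds.

Arguments chart R M n : clear implicits.
Arguments manifold R n : clear implicits.
Arguments riemannian R n : clear implicits.
Arguments kahler R m : clear implicits.

(* Main.v *)
Require Import Defs.
From HB Require Import structures.
From mathcomp Require Import all_boot all_order all_algebra.
From mathcomp Require Import all_classical all_reals all_analysis.
From mathcomp Require Import perm ring lra.
Import Order.TTheory GRing.Theory Num.Theory.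
Import numFieldNormedType.Exports.
Set Implicit Arguments.
Unset Strict Implicit.
Unset Printing Implicit Defensive.
Local Open Scope classical_set_scope.
Local Open Scope ring_scope.

(* In a chart, let the rows of D be the derivatives of the immersion F, g the
   ambient metric along F, G = D g D^T, and S_i = nabla_i D the second
   fundamental form.  Commuting the covariant derivatives of D gives the Gauss
   equation as a matrix identity
     R_ij G = D R'_ij g D^T + S_j g S_i^T - S_i g S_j^T.
   Polarizing constant holomorphic curvature 4c on X + Y and X - Y gives
     R'(X,Y,Y,X) = c (|X|^2 |Y|^2 - <X,Y>^2 + 3 <X,JY>^2),
   so that, with Y = J xi, A the shape operator, t = tr A and a = <AY,Y>,
     Ric(Y,Y) = 2hc + t a - |AY|^2.
   As |Y| = 1 and t^2/2 = n^2 H^2/2, the inequality and its equality case are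
     t^2/2 - t a + |AY|^2 = ((t - a)^2 + a^2)/2 + |AY - aY|^2 >= 0. *)

(** * Calculus of matrix-valued functions *)

(** The field [xi] is an arbitrary pointwise choice of unit normal with no regularity, so it can
    never be differentiated. The second fundamental form is therefore kept as an ambient-valued
    matrix built from the immersion and the two metrics alone; [xi] enters only after all
    derivatives have been taken, when codimension one makes every normal vector a multiple of it.
    The same fact links the chosen [xi] to the Hopf condition, which quantifies over all unit
    normals at a point. The constant 2hc arises because Y = J xi is tangent while JY = -xi is
    normal: for tangent X the term 3 <X,JY>^2 vanishes, R'(X,Y,Y,X) = c (|X|^2 - <X,Y>^2), and the
    trace of this form is c (n - 1) with n = 2h + 1. Every commutation of covariant derivatives
    rests on the symmetry of mixed partial derivatives, which has to be obtained from smoothness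
    phrased as differentiability of all iterated partial derivatives. *)

Lemma differentiable_entry (R : realType) (V : normedModType R) p q
  (f : V -> 'M[R]_(p, q)) x i j :
  differentiable f x -> differentiable (fun y => f y i j) x.
Proof.
move=> df; apply: (@differentiable_comp _ _ _ _ f (fun N : 'M[R]_(p, q) => N i j)) => //.
exact: differentiable_coord.
Qed.

Lemma differentiable_mx (R : realType) (V : normedModType R) p q
  (f : V -> 'M[R]_(p, q)) x :
  (forall i j, differentiable (fun y => f y i j) x) -> differentiable f x.
Proof.
move=> df.
have -> : f = \sum_i \sum_j (fun y => f y i j *: delta_mx i j).
  apply/funext => y; rewrite fct_sumE [LHS]matrix_sum_delta.
  by apply: eq_bigr => i _; rewrite fct_sumE.
by apply: differentiable_sum => i; apply: differentiable_sum => j;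
  apply: differentiableZl.
Qed.

Lemma differentiable_mulmx (R : realType) (V : normedModType R) p q r
  (f : V -> 'M[R]_(p, q)) (g : V -> 'M[R]_(q, r)) x :
  differentiable f x -> differentiable g x ->
  differentiable (fun y => f y *m g y) x.
Proof.
move=> df dg; apply: differentiable_mx => i j.
have -> : (fun y => (f y *m g y) i j) =
  \sum_k ((fun y => f y i k) * (fun y => g y k j)).
  by apply/funext => y; rewrite fct_sumE mxE.
by apply: differentiable_sum => k; apply: differentiableM;
  apply: differentiable_entry.
Qed.

Lemma differentiable_tr (R : realType) (V : normedModType R) p q
  (f : V -> 'M[R]_(p, q)) x :
  differentiable f x -> differentiable (fun y => (f y)^T) x.
Proof.
move=> df; apply: differentiable_mx => i j.
have -> : (fun y => (f y)^T i j) = (fun y => f y j i).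
  by apply/funext => y; rewrite mxE.
exact: differentiable_entry.
Qed.

Lemma differentiable_prod (R : realType) (V : normedModType R) (I : Type)
  (r : seq I) (f : I -> V -> R) x :
  (forall i, differentiable (f i) x) ->
  differentiable (fun y => \prod_(i <- r) f i y) x.
Proof.
move=> df; elim: r => [|a r IH].
  have -> : (fun y => \prod_(i <- [::]) f i y) = cst 1.
    by apply/funext => y; rewrite big_nil.
  exact: differentiable_cst.
have -> : (fun y => \prod_(i <- a :: r) f i y) =
  f a * (fun y => \prod_(i <- r) f i y).
  by apply/funext => y; rewrite big_cons.
exact: differentiableM.
Qed.

Lemma differentiable_bigsum (R : realType) (V W : normedModType R) (I : Type)
  (r : seq I) (f : I -> V -> W) x :
  (forall i, differentiable (f i) x) ->
  differentiable (fun y => \sum_(i <- r) f i y) x.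
Proof.
move=> df; elim: r => [|a r IH].
  have -> : (fun y => \sum_(i <- [::]) f i y) = cst 0.
    by apply/funext => y; rewrite big_nil.
  exact: differentiable_cst.
have -> : (fun y => \sum_(i <- a :: r) f i y) =
  f a + (fun y => \sum_(i <- r) f i y).
  by apply/funext => y; rewrite big_cons.
exact: differentiableD.
Qed.

Lemma differentiable_det (R : realType) (V : normedModType R) p
  (f : V -> 'M[R]_p) x :
  differentiable f x -> differentiable (fun y => \det (f y)) x.
Proof.
move=> df; apply: differentiable_bigsum => s.
rewrite -[X in differentiable X _]/(cst ((-1) ^+ odd_perm s) * (fun y => \prod_i f y i (s i))).
apply: differentiableM => //.
by apply: differentiable_prod => i; apply: differentiable_entry.
Qed.

Lemma differentiable_littleo (R : realType) (V W : normedModType R)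
  (f : V -> W) x (e : R) : differentiable f x -> 0 < e ->
  \forall h \near (0 : V), `|f (h + x) - f x - 'd f x h| <= e * `|h|.
Proof.
move=> /diff_locally/eqaddoP/(_ e) + e0 => /(_ e0).
by apply: filterS => h; rewrite /= opprD addrA.
Qed.

(** Differentiability is local: the first-order expansion of f is one for g, and [diff_unique] then
    identifies the differential. This is needed because most identities below hold only on an open
    set. *)
Lemma near_eq_differentiable (R : realType) (V W : normedModType R)
  (f g : V -> W) x :
  (\forall y \near x, f y = g y) -> differentiable f x -> differentiable g x.
Proof.
move=> fg df.
have fg0 : \forall h \near (0 : V), f (h + x) = g (h + x).
  by have := fg; rewrite (near_shift 0) /= subr0.
have E : g \o shift x = cst (g x) + 'd f x +o_ 0 id.
  apply/eqaddoP => e e0; near=> h.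
  have -> : (g \o shift x - (cst (g x) + 'd f x)) h =
      f (h + x) - f x - 'd f x h.
    have -> : f (h + x) = g (h + x).
      by near: h.
    by rewrite (nbhs_singleton fg) opprD addrA.
  near: h; exact: differentiable_littleo.
have dc : continuous ('d f x) by exact: diff_continuous.
by apply/diff_locallyP; rewrite (diff_unique dc E).
Unshelve. all: by end_near. Qed.

(** By Cramer's formula. Invertibility is required near x, not just at x, because [invmx] returns
    its argument unchanged on singular matrices. *)
Lemma differentiable_invmx (R : realType) (V : normedModType R) p
  (f : V -> 'M[R]_p) x :
  (\forall y \near x, f y \in unitmx) ->
  differentiable f x -> differentiable (fun y => invmx (f y)) x.
Proof.
move=> uf df.
apply: (@near_eq_differentiable _ _ _ (fun y => (\det (f y))^-1 *: \adj (f y))).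
  by near=> y; rewrite /invmx; have -> : f y \in unitmx by near: y.
have d0 : \det (f x) != 0.
  by have := nbhs_singleton uf; rewrite unitmxE unitfE.
apply: differentiable_mx => i j.
have -> : (fun y => ((\det (f y))^-1 *: \adj (f y)) i j) =
  (fun y => (\det (f y))^-1) * (fun y => (-1) ^+ (j + i) * \det (row' j (col' i (f y)))).
  by apply/funext => y; rewrite !mxE.
apply: differentiableM.
  by apply: differentiableV => //; exact: differentiable_det.
rewrite -[X in differentiable X _]/(cst ((-1) ^+ (j + i)) * (fun y => \det (row' j (col' i (f y))))).
apply: differentiableM => //.
apply: differentiable_det; apply: differentiable_mx => a b.
have -> : (fun y => row' j (col' i (f y)) a b) = (fun y => f y (lift j a) (lift i b)).
  by apply/funext => y; rewrite !mxE.
exact: differentiable_entry.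
Unshelve. all: by end_near. Qed.

(** * Symmetry of second derivatives *)

Lemma is_derive_line (R : realType) (V W : normedModType R) (f : V -> W)
  (a u : V) (s : R) : derivable f (s *: u + a) u ->
  is_derive s (1 : R) (fun r : R => f (r *: u + a)) ('D_u f (s *: u + a)).
Proof.
move=> df.
have E : (fun h : R => h^-1 *: (((fun r : R => f (r *: u + a)) \o shift s) (h *: 1)
    - f (s *: u + a))) =
  (fun h : R => h^-1 *: ((f \o shift (s *: u + a)) (h *: u) - f (s *: u + a))).
  by apply/funext => h /=; rewrite [h *: 1]mulr1 scalerDl addrA.
by apply: DeriveDef; rewrite /derivable/derive E.
Qed.

(** The mean value theorem along u reduces the second difference to t times a difference of values
    of ['D_u f], which is then expanded to first order at x. The expansions at su + tv and at su
    contribute the errors |u| + |v| and |u|, whence 2|u| + |v|. *)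
Lemma second_difference (R : realType) (V : normedModType R) (f : V -> R)
  (x u v : V) (e : R) :
  (\forall y \near x, differentiable f y) ->
  differentiable ('D_u f) x -> 0 < e ->
  exists2 d, 0 < d & forall t, 0 < t < d ->
   `|f (t *: u + (t *: v + x)) - f (t *: u + x) - f (t *: v + x) + f x
     - t ^+ 2 * 'd ('D_u f) x v| <= e * (2 * `|u| + `|v|) * t ^+ 2.
Proof.
move=> df ddf e0.
have := differentiable_littleo ddf e0 => H1.
have H2 : \forall h \near (0 : V), differentiable f (h + x).
  by have := df; rewrite (near_shift 0) /= subr0.
have [r /= r0 Hr] := (nbhs_ballP _ _).1 (filterI H1 H2).
(* With t * K < r all points s u + q v with s, q in [0, t] stay in the ball; the summand 1 keeps K
   positive when u = v = 0. *)
pose K := `|u| + `|v| + 1.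
have K0 : 0 < K by rewrite /K ltr_wpDl ?addr_ge0.
exists (r / K); first by rewrite divr_gt0.
move=> t /andP[t0 tr].
have tr' : t * K < r by rewrite -ltr_pdivlMr.
have in_ball (s q : R) : 0 <= s <= t -> 0 <= q <= t -> ball 0 r (s *: u + q *: v).
  move=> /andP[s0 st] /andP[q0 qt]; rewrite -ball_normE /= sub0r normrN.
  apply: le_lt_trans (ler_normD _ _) _; rewrite !normrZ !ger0_norm //.
  apply: le_lt_trans tr'; rewrite /K !mulrDr mulr1 -[leLHS]addr0 lerD ?(ltW t0) //.
  by apply: lerD; apply: ler_wpM2r.
have tI : 0 <= t <= t by lra.
have oI : 0 <= (0 : R) <= t by lra.
pose phi (s : R) := f (s *: u + (t *: v + x)) - f (s *: u + x).
pose dphi (s : R) := 'D_u f (s *: u + (t *: v + x)) - 'D_u f (s *: u + x).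
have dphiP (s : R) : 0 <= s <= t -> is_derive s (1 : R) phi (dphi s).
  move=> st.
  apply: is_deriveB; apply: is_derive_line; apply: diff_derivable.
    by have [_] := Hr _ (in_ball s t st tI); rewrite addrA.
  by have [_] := Hr _ (in_ball s 0 st oI); rewrite scale0r addr0.
have [] := @MVT R phi dphi 0 t t0.
- by move=> s; rewrite in_itv /= => /andP[/ltW ? /ltW ?]; apply: dphiP; apply/andP.
- apply: derivable_within_continuous => s; rewrite in_itv /= => st.
  by have [] := dphiP s st.
move=> s; rewrite in_itv /= => /andP[s0 st] E.
have sI : 0 <= s <= t by rewrite !ltW.
have [R1 _] := Hr _ (in_ball s t sI tI).
have [R2 _] := Hr _ (in_ball s 0 sI oI).
rewrite linearD !linearZ /= -(addrA (s *: u)) in R1.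
rewrite scale0r addr0 linearZ /= in R2.
have -> : f (t *: u + (t *: v + x)) - f (t *: u + x) - f (t *: v + x) + f x
     - t ^+ 2 * 'd ('D_u f) x v = t * (dphi s - t * 'd ('D_u f) x v).
  move: E; rewrite /phi !scale0r !add0r subr0 => E.
  by rewrite mulrBr [t * dphi s]mulrC -E expr2 -mulrA; ring.
rewrite normrM gtr0_norm // mulrC expr2 mulrA ler_pM2r //.
(* The contributions of s u to the two expansions cancel, leaving only the derivative along v. *)
have -> : dphi s - t * 'd ('D_u f) x v =
  ('D_u f (s *: u + (t *: v + x)) - 'D_u f x - (s *: 'd ('D_u f) x u + t *: 'd ('D_u f) x v))
  - ('D_u f (s *: u + x) - 'D_u f x - s *: 'd ('D_u f) x u).
  by rewrite /dphi /GRing.scale /=; ring.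
apply: le_trans (ler_normB _ _) _; apply: le_trans (lerD R1 R2) _.
rewrite -mulrDr -mulrA ler_wpM2l ?(ltW e0) //.
apply: le_trans (lerD (ler_normD _ _) (lexx _)) _; rewrite !normrZ !gtr0_norm //.
have : s * `|u| <= t * `|u| by rewrite ler_wpM2r // ltW.
lra.
Qed.

Lemma quadratic_coef_unique (R : realType) (q : R -> R) (k1 k2 D1 D2 : R) :
  0 <= k1 -> 0 <= k2 ->
  (forall e, 0 < e -> exists2 d, 0 < d &
    forall t, 0 < t < d -> `|q t - t ^+ 2 * D1| <= e * k1 * t ^+ 2) ->
  (forall e, 0 < e -> exists2 d, 0 < d &
    forall t, 0 < t < d -> `|q t - t ^+ 2 * D2| <= e * k2 * t ^+ 2) ->
  D1 = D2.
Proof.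
move=> k10 k20 H1 H2; apply/eqP; rewrite -subr_eq0 -normr_le0.
apply/ler_addgt0Pr => e e0; rewrite add0r.
have K0 : 0 < k1 + k2 + 1 by rewrite ltr_wpDl ?addr_ge0.
(* Scaled so that the two errors add up to at most e t^2; the summand 1 covers k1 = k2 = 0. *)
have eK0 : 0 < e / (k1 + k2 + 1) by rewrite divr_gt0.
have [d1 d10 {}H1] := H1 _ eK0; have [d2 d20 {}H2] := H2 _ eK0.
pose t := Num.min d1 d2 / 2.
have m0 : 0 < Num.min d1 d2 by rewrite lt_min d10.
have t0 : 0 < t by rewrite divr_gt0.
have tm : t < Num.min d1 d2 by rewrite /t; lra.
move: tm; rewrite lt_min => /andP[t1 t2].
have {H1}H1 : `|q t - t ^+ 2 * D1| <= _ := H1 t (introT andP (conj t0 t1)).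
have {H2}H2 : `|q t - t ^+ 2 * D2| <= _ := H2 t (introT andP (conj t0 t2)).
have t20 : 0 < t ^+ 2 by rewrite exprn_gt0.
rewrite -(ler_pM2r t20) -[X in _ * X](ger0_norm (ltW t20)) -normrM.
have -> : (D1 - D2) * t ^+ 2 = (q t - t ^+ 2 * D2) - (q t - t ^+ 2 * D1) by ring.
apply: le_trans (ler_normB _ _) _; apply: le_trans (lerD H2 H1) _.
rewrite -mulrDl -mulrDr ler_pM2r //.
apply: le_trans (_ : e / (k1 + k2 + 1) * (k1 + k2 + 1) <= _); last by rewrite divfK ?gt_eqF.
by rewrite ler_pM2l //; lra.
Qed.

(* Young's form of the theorem of Schwarz: both mixed derivatives are the limit
   of the second difference quotient. *)
Lemma derive_swap (R : realType) (V : normedModType R) (f : V -> R)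
  (x u v : V) :
  (\forall y \near x, differentiable f y) ->
  differentiable ('D_u f) x -> differentiable ('D_v f) x ->
  'D_v ('D_u f) x = 'D_u ('D_v f) x.
Proof.
move=> df du dv; rewrite [LHS](deriveE v du) [RHS](deriveE u dv).
apply: (@quadratic_coef_unique _ (fun t => f (t *: u + (t *: v + x)) - f (t *: u + x)
  - f (t *: v + x) + f x) (2 * `|u| + `|v|) (2 * `|v| + `|u|)).
- by rewrite addr_ge0 ?mulr_ge0.
- by rewrite addr_ge0 ?mulr_ge0.
- by move=> e e0; exact: second_difference.
move=> e e0; have [d d0 H] := second_difference u df dv e0; exists d => // t td.
have -> : f (t *: u + (t *: v + x)) - f (t *: u + x) - f (t *: v + x) + f x =
  f (t *: v + (t *: u + x)) - f (t *: v + x) - f (t *: u + x) + f x.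
  by rewrite (addrCA (t *: u)); congr (_ + _); rewrite addrAC.
exact: H.
Qed.

(** * Rules for partial derivatives *)

Lemma pd_near (R : realType) n (V : normedModType R) (i : 'I_n)
  (F G : 'rV[R]_n -> V) x :
  (\forall y \near x, F y = G y) -> pd i F x = pd i G x.
Proof. exact: near_eq_derive. Qed.

Lemma pdD (R : realType) n (V : normedModType R) (i : 'I_n)
  (F G : 'rV[R]_n -> V) x : differentiable F x -> differentiable G x ->
  pd i (fun y => F y + G y) x = pd i F x + pd i G x.
Proof. by move=> dF dG; apply: deriveD; apply: diff_derivable. Qed.

Lemma pdB (R : realType) n (V : normedModType R) (i : 'I_n)
  (F G : 'rV[R]_n -> V) x : differentiable F x -> differentiable G x ->
  pd i (fun y => F y - G y) x = pd i F x - pd i G x.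
Proof. by move=> dF dG; apply: deriveB; apply: diff_derivable. Qed.

Lemma pd_sum (R : realType) n (V : normedModType R) (i : 'I_n) (I : finType)
  (F : I -> 'rV[R]_n -> V) x : (forall a, differentiable (F a) x) ->
  pd i (fun y => \sum_a F a y) x = \sum_a pd i (F a) x.
Proof.
move=> dF; elim: (index_enum I) => [|a r IH].
  rewrite big_nil -[RHS](@derive_cst R _ V 0 x (delta_mx 0 i)); congr (pd i _ x).
  by apply/funext => y; rewrite big_nil.
rewrite big_cons -IH -pdD //; last exact: differentiable_bigsum.
by congr (pd i _ x); apply/funext => y; rewrite big_cons.
Qed.

Lemma pd_entry (R : realType) n (k : 'I_n) p q (F : 'rV[R]_n -> 'M[R]_(p, q))
  x i j : differentiable F x -> pd k F x i j = pd k (fun y => F y i j) x.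
Proof. by move=> dF; rewrite /pd derive_mx ?mxE //; exact: diff_derivable. Qed.

Lemma pd_mul (R : realType) n (k : 'I_n) (f g : 'rV[R]_n -> R) x :
  differentiable f x -> differentiable g x ->
  pd k (fun y => f y * g y) x = pd k f x * g x + f x * pd k g x.
Proof.
move=> df dg; rewrite /pd -[LHS]/('D_(delta_mx 0 k) (f * g) x) deriveM;
  try exact: diff_derivable.
by rewrite addrC /GRing.scale /= mulrC.
Qed.

Lemma pd_mulmx (R : realType) n (k : 'I_n) p q r (F : 'rV[R]_n -> 'M[R]_(p, q))
  (G : 'rV[R]_n -> 'M[R]_(q, r)) x : differentiable F x -> differentiable G x ->
  pd k (fun y => F y *m G y) x = pd k F x *m G x + F x *m pd k G x.
Proof.
move=> dF dG; apply/matrixP => i j.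
rewrite pd_entry; last exact: differentiable_mulmx.
rewrite !mxE -big_split /=.
rewrite -[LHS]/(pd k (fun y => (F y *m G y) i j) x).
under eq_fun do rewrite mxE.
rewrite pd_sum => [|a]; last by apply: differentiableM; apply: differentiable_entry.
by apply: eq_bigr => a _; rewrite pd_mul ?pd_entry //; apply: differentiable_entry.
Qed.

Lemma pd_tr (R : realType) n (k : 'I_n) p q (F : 'rV[R]_n -> 'M[R]_(p, q)) x :
  differentiable F x -> pd k (fun y => (F y)^T) x = (pd k F x)^T.
Proof.
move=> dF; apply/matrixP => i j; rewrite pd_entry; last exact: differentiable_tr.
by rewrite mxE pd_entry //; under eq_fun do rewrite mxE.
Qed.

Lemma differentiable_scale (R : realType) (V : normedModType R)
  (f : V -> R) p q (G : V -> 'M[R]_(p, q)) x :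
  differentiable f x -> differentiable G x ->
  differentiable (fun y => f y *: G y) x.
Proof.
move=> df dG; apply: differentiable_mx => i j; under eq_fun do rewrite mxE.
by apply: differentiableM => //; exact: differentiable_entry.
Qed.

Lemma pd_scale (R : realType) n (k : 'I_n)
  (f : 'rV[R]_n -> R) p q (G : 'rV[R]_n -> 'M[R]_(p, q)) x :
  differentiable f x -> differentiable G x ->
  pd k (fun y => f y *: G y) x = pd k f x *: G x + f x *: pd k G x.
Proof.
move=> df dG; apply/matrixP => i j.
rewrite pd_entry; last exact: differentiable_scale.
under eq_fun do rewrite mxE.
rewrite pd_mul //; last exact: differentiable_entry.
by rewrite !mxE pd_entry.
Qed.

Lemma pd_comp (R : realType) n m (V : normedModType R) (k : 'I_n)
  (F : 'rV[R]_n -> 'rV[R]_m) (G : 'rV[R]_m -> V) x :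
  differentiable F x -> differentiable G (F x) ->
  pd k (fun y => G (F y)) x = \sum_a pd k F x 0 a *: pd a G (F x).
Proof.
move=> dF dG; rewrite /pd -[LHS]/('D_(delta_mx 0 k) (G \o F) x).
rewrite !deriveE //; last exact: differentiable_comp.
rewrite diff_comp //= [X in 'd G _ X]row_sum_delta linear_sum.
by apply: eq_bigr => a _; rewrite linearZ /= deriveE.
Qed.

Lemma smooth_differentiable (R : realType) n (V : normedModType R)
  (U : set 'rV[R]_n) (F : 'rV[R]_n -> V) x :
  smooth_on U F -> U x -> differentiable F x.
Proof. by move=> sF Ux; exact: (sF [::] x Ux). Qed.

Lemma smooth_pd (R : realType) n (V : normedModType R)
  (U : set 'rV[R]_n) (F : 'rV[R]_n -> V) i :
  smooth_on U F -> smooth_on U (pd i F).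
Proof. by move=> sF s x Ux; have := sF (rcons s i) x Ux; rewrite foldr_rcons. Qed.

Lemma smooth_sub (R : realType) n (V : normedModType R)
  (U U' : set 'rV[R]_n) (F : 'rV[R]_n -> V) :
  U' `<=` U -> smooth_on U F -> smooth_on U' F.
Proof. by move=> UU sF s x /UU; exact: sF. Qed.

Lemma pd_swap (R : realType) n (U : set 'rV[R]_n) p q
  (F : 'rV[R]_n -> 'M[R]_(p, q)) i j x : open U -> smooth_on U F -> U x ->
  pd i (pd j F) x = pd j (pd i F) x.
Proof.
move=> oU sF Ux.
have dF k : differentiable (pd k F) x.
  exact: smooth_differentiable (smooth_pd k sF) Ux.
have nU : \forall y \near x, U y by exact: open_nbhs_nbhs.
have E a b k l y : U y -> pd l F y a b = pd l (fun y => F y a b) y.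
  by move=> Uy; rewrite pd_entry //; exact: smooth_differentiable sF Uy.
have dFe a b k : differentiable (pd k (fun y => F y a b)) x.
  apply: near_eq_differentiable (differentiable_entry a b (dF k)).
  by near=> y; apply: E => //; near: y.
apply/matrixP => a b.
have H k l : pd k (pd l F) x a b = pd k (pd l (fun y => F y a b)) x.
  transitivity (pd k (fun y => pd l F y a b) x); first exact: pd_entry.
  by apply: pd_near; near=> y; apply: E => //; near: y.
apply: etrans (H i j) _; apply: etrans (esym (H j i)).
apply: derive_swap; [|exact: dFe..].
near=> y; apply: differentiable_entry; apply: smooth_differentiable sF _.
by near: y.
Unshelve. all: by end_near. Qed.

(** * Levi-Civita connection in coordinates *)

(** Symmetry and invertibility are what the connection and curvature identities use; positivity is
    supplied separately where a norm must be nonzero. The set is open so that identities on it can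
    be differentiated. *)
Definition metric_on (R : realType) n (U : set 'rV[R]_n)
  (G : 'rV[R]_n -> 'M[R]_n) : Prop :=
  [/\ open U, smooth_on U G, forall x, U x -> (G x)^T = G x &
      forall x, U x -> G x \in unitmx].

Lemma metric_on_sub (R : realType) n (U U' : set 'rV[R]_n) G :
  open U' -> U' `<=` U -> metric_on U G -> metric_on U' G.
Proof.
move=> oU' UU [_ sG symG uG]; split=> //; first exact: smooth_sub sG.
  by move=> x /UU; exact: symG.
by move=> x /UU; exact: uG.
Qed.



Lemma pd_sym (R : realType) n (U : set 'rV[R]_n) G k i l x :
  metric_on U G -> U x -> pd k G x i l = pd k G x l i.
Proof.
move=> [oU sG symG _] Ux.
have nU : \forall y \near x, U y by exact: open_nbhs_nbhs.
have dG := smooth_differentiable sG Ux.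
have {1}-> : pd k G x = (pd k G x)^T; last by rewrite mxE.
rewrite -pd_tr //; apply: pd_near; near=> y.
by rewrite symG //; near: y.
Unshelve. all: by end_near. Qed.

Lemma christoffel_mulG (R : realType) n (U : set 'rV[R]_n) G k i l x :
  metric_on U G -> U x ->
  (christoffel G k x *m G x) i l =
  (pd k G x i l + pd i G x k l - pd l G x k i) / 2.
Proof. by move=> [_ _ _ uG] Ux; rewrite mulmxKV ?uG // mxE. Qed.

(** This is nabla g = 0: [christoffel G k x *m G x] holds the lowered Christoffel symbols, and
    symmetrizing the Koszul expression in its last two indices leaves d_k g_il. *)
Lemma metric_compatible (R : realType) n (U : set 'rV[R]_n) G k x :
  metric_on U G -> U x ->
  pd k G x = christoffel G k x *m G x + (christoffel G k x *m G x)^T.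
Proof.
move=> mG Ux; apply/matrixP => i l; rewrite [RHS]mxE [X in _ + X]mxE.
rewrite [X in X + _](christoffel_mulG k i l mG Ux).
rewrite [X in _ + X](christoffel_mulG k l i mG Ux).
have H (T : 'I_n -> 'I_n -> 'I_n -> R) : (forall k i l, T k i l = T k l i) ->
    T k i l = (T k i l + T i k l - T l k i) / 2 + (T k l i + T l k i - T i k l) / 2.
  by move=> sT; rewrite (sT k l i); field.
by apply: (H (fun k i l => pd k G x i l)) => a b c; exact: pd_sym mG Ux.
Qed.

(** The lowered symbols are visibly symmetric in k and i; invertibility of the metric raises the
    last index. *)
Lemma torsion_free (R : realType) n (U : set 'rV[R]_n) G k i l x :
  metric_on U G -> U x -> christoffel G k x i l = christoffel G i x k l.
Proof.
move=> mG Ux; have uG : G x \in unitmx by case: mG => _ _ _; apply.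
have: row i (christoffel G k x) *m G x = row k (christoffel G i x) *m G x.
  apply/rowP => j; rewrite -!row_mul [LHS]mxE [RHS]mxE.
  apply: etrans (christoffel_mulG k i j mG Ux) _.
  apply: etrans (esym (christoffel_mulG i k j mG Ux)).
  by rewrite [X in X - _]addrC; congr ((_ - _) / _); exact: pd_sym mG Ux.
move/(can_inj (mulmxK uG))/rowP/(_ l).
by rewrite !mxE.
Qed.

Lemma differentiable_christoffel (R : realType) n (U : set 'rV[R]_n) G k x :
  metric_on U G -> U x -> differentiable (christoffel G k) x.
Proof.
move=> [oU sG symG uG] Ux.
have dG i : differentiable (pd i G) x := smooth_differentiable (smooth_pd i sG) Ux.
apply: differentiable_mulmx; last first.
  apply: differentiable_invmx; last exact: smooth_differentiable sG Ux.
  have nU : \forall y \near x, U y by exact: open_nbhs_nbhs.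
  by near=> y; apply: uG; near: y.
apply: differentiable_mx => i l.
under eq_fun do rewrite mxE mulrC.
apply: (@differentiableZ _ _ _ _ (2^-1)).
by apply: differentiableB; [apply: differentiableD|]; exact: differentiable_entry.
Unshelve. all: by end_near. Qed.

(** * Pulled-back connection and the Gauss equation *)

(** Agrees with ['J F x] wherever F is differentiable, but has partial derivatives as entries, so
    that it can itself be differentiated entrywise. *)
Definition jacobian_mx (R : realType) n m (F : 'rV[R]_n -> 'rV[R]_m) x :
  'M[R]_(n, m) := \matrix_(i, j) pd i F x 0 j.

Lemma row_jacobian_mx (R : realType) n m (F : 'rV[R]_n -> 'rV[R]_m) i x :
  row i (jacobian_mx F x) = pd i F x.
Proof. by apply/rowP => j; rewrite !mxE. Qed.

Lemma jacobian_mxE (R : realType) n m (F : 'rV[R]_n -> 'rV[R]_m) x :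
  differentiable F x -> 'J F x = jacobian_mx F x.
Proof.
move=> dF; apply/row_matrixP => i.
by rewrite row_jacobian_mx rowE -deriveEjacobian.
Qed.

Lemma smooth_jacobian_mx (R : realType) n m (U : set 'rV[R]_n)
  (F : 'rV[R]_n -> 'rV[R]_m) :
  open U -> smooth_on U F -> smooth_on U (jacobian_mx F).
Proof.
move=> oU sF.
(* [M s] is the matrix of iterated derivatives of the entries. It equals the iterated derivative of
   the matrix only on U, so the induction passes through equality near each point. *)
pose M s y : 'M[R]_(n, m) := \matrix_(i, j) foldr (@pd R n _) (pd i F) s y 0 j.
have dM s x : U x -> differentiable (M s) x.
  move=> Ux; apply: differentiable_mx => i j; under eq_fun do rewrite mxE.
  by apply: differentiable_entry; apply: (smooth_pd i sF).
have H s x : U x -> foldr (@pd R n _) (jacobian_mx F) s x = M s x.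
  elim: s x => [//|k s IH] x Ux /=.
  have nU : \forall y \near x, U y by exact: open_nbhs_nbhs.
  have -> : pd k (foldr (@pd R n _) (jacobian_mx F) s) x = pd k (M s) x.
    by apply: pd_near; near=> y; apply: IH; near: y.
  apply/matrixP => i j; rewrite [RHS]mxE.
  apply: etrans (pd_entry k i j (dM s x Ux)) _.
  apply: etrans _ (esym (pd_entry k 0 j (smooth_pd i sF s Ux))).
  by congr (pd k _ x); apply/funext => y; rewrite mxE.
move=> s x Ux; apply: near_eq_differentiable (dM s x Ux).
have nU : \forall y \near x, U y by exact: open_nbhs_nbhs.
by near=> y; rewrite H //; near: y.
Unshelve. all: by end_near. Qed.

Lemma row_pd_jacobian_mx (R : realType) n m (U : set 'rV[R]_n)
  (F : 'rV[R]_n -> 'rV[R]_m) i j x :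
  open U -> smooth_on U F -> U x ->
  row j (pd i (jacobian_mx F) x) = pd i (pd j F) x.
Proof.
move=> oU sF Ux; apply/rowP => l; rewrite mxE.
have dJ := smooth_differentiable (smooth_jacobian_mx oU sF) Ux.
apply: etrans (pd_entry i j l dJ) _.
apply: etrans _ (esym (pd_entry i 0 l (smooth_differentiable (smooth_pd j sF) Ux))).
by congr (pd i _ x); apply/funext => y; rewrite mxE.
Qed.

(** Connection matrix, in the direction d_i, of the pulled-back bundle F^*TM; it acts on the right
    on components of vector fields along F. *)
Definition pullback_connection (R : realType) n m (G' : 'rV[R]_m -> 'M[R]_m)
  (F : 'rV[R]_n -> 'rV[R]_m) (i : 'I_n) (x : 'rV[R]_n) : 'M[R]_m :=
  \sum_a pd i F x 0 a *: christoffel G' a (F x).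

Lemma connection_term_mx (R : realType) n m (G' : 'rV[R]_m -> 'M[R]_m)
  (F : 'rV[R]_n -> 'rV[R]_m) (i : 'I_n) (x : 'rV[R]_n) w :
  connection_term G' (F x) (pd i F x) w = w *m pullback_connection G' F i x.
Proof.
rewrite /connection_term /pullback_connection mulmx_sumr.
by apply: eq_bigr => a _; rewrite scalemxAr.
Qed.

Lemma pullback_metric_compatible (R : realType) n m (U' : set 'rV[R]_m)
  (G' : 'rV[R]_m -> 'M[R]_m) (F : 'rV[R]_n -> 'rV[R]_m) i x :
  metric_on U' G' -> differentiable F x -> U' (F x) ->
  pd i (fun y => G' (F y)) x = pullback_connection G' F i x *m G' (F x) +
    (pullback_connection G' F i x *m G' (F x))^T.
Proof.
move=> mG dF Ux; have [oU sG _ _] := mG.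
rewrite pd_comp //; last exact: smooth_differentiable sG Ux.
rewrite mulmx_suml raddf_sum -big_split /=; apply: eq_bigr => a _.
rewrite -scalemxAl linearZ /= -scalerDr; congr (_ *: _).
exact: metric_compatible mG Ux.
Qed.

Lemma pullback_torsion_free (R : realType) n m (U' : set 'rV[R]_m)
  (G' : 'rV[R]_m -> 'M[R]_m) (F : 'rV[R]_n -> 'rV[R]_m) i j x :
  metric_on U' G' -> U' (F x) ->
  pd j F x *m pullback_connection G' F i x =
  pd i F x *m pullback_connection G' F j x.
Proof.
move=> mG Ux.
have E (C : 'I_m -> 'M[R]_m) (u v : 'rV[R]_m) :
    (forall a b, row b (C a) = row a (C b)) ->
    v *m (\sum_a u 0 a *: C a) = u *m (\sum_a v 0 a *: C a).
  move=> sC; have H (s t : 'rV[R]_m) : s *m (\sum_a t 0 a *: C a) =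
      \sum_b \sum_a (t 0 a * s 0 b) *: row b (C a).
    rewrite [in LHS](row_sum_delta s) mulmx_suml; apply: eq_bigr => b _.
    rewrite mulmx_sumr; apply: eq_bigr => a _.
    by rewrite -scalemxAl -scalemxAr scalerA -rowE mulrC.
  rewrite !H exchange_big /=; apply: eq_bigr => a _; apply: eq_bigr => b _.
  by rewrite mulrC sC.
apply: E => a b; apply/rowP => l; rewrite [LHS]mxE [RHS]mxE.
exact: torsion_free mG Ux.
Qed.

Lemma differentiable_pullback_connection (R : realType) n m (U : set 'rV[R]_n)
  (U' : set 'rV[R]_m) (G' : 'rV[R]_m -> 'M[R]_m) (F : 'rV[R]_n -> 'rV[R]_m) i x :
  metric_on U' G' -> smooth_on U F -> U x -> U' (F x) ->
  differentiable (pullback_connection G' F i) x.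
Proof.
move=> mG sF Ux U'x; apply: differentiable_bigsum => a.
apply: differentiable_scale.
  by apply: differentiable_entry; exact: smooth_differentiable (smooth_pd i sF) Ux.
apply: (@differentiable_comp _ _ _ _ F (christoffel G' a)).
  exact: smooth_differentiable sF Ux.
exact: differentiable_christoffel mG U'x.
Qed.

(** The curvature of a pulled-back connection is the pulled-back curvature. By the chain rule the
    only other terms contain second derivatives of F, and these are symmetric in i and j. *)
Lemma pullback_curvature (R : realType) n m (U : set 'rV[R]_n)
  (U' : set 'rV[R]_m) (G' : 'rV[R]_m -> 'M[R]_m) (F : 'rV[R]_n -> 'rV[R]_m) i j x :
  metric_on U' G' -> open U -> smooth_on U F -> U x -> U' (F x) ->
  let P := pullback_connection G' F in
  pd i (P j) x - pd j (P i) x + P j x *m P i x - P i x *m P j x =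
  \sum_a \sum_b (pd i F x 0 a * pd j F x 0 b) *: curvature_mx G' a b (F x).
Proof.
move=> mG oU sF Ux U'x P.
have dF := smooth_differentiable sF Ux.
have dpF k : differentiable (pd k F) x := smooth_differentiable (smooth_pd k sF) Ux.
have dC a : differentiable (christoffel G' a) (F x) := differentiable_christoffel a mG U'x.
have dCF a : differentiable (fun y => christoffel G' a (F y)) x.
  exact: (@differentiable_comp _ _ _ _ F (christoffel G' a)).
have dP k l : pd k (P l) x =
    \sum_a pd k (pd l F) x 0 a *: christoffel G' a (F x) +
    \sum_a \sum_b (pd k F x 0 a * pd l F x 0 b) *: pd a (christoffel G' b) (F x).
  rewrite [LHS]pd_sum => [|a]; last first.
    by apply: differentiable_scale => //; exact: differentiable_entry.
  rewrite exchange_big -big_split /=; apply: eq_bigr => a _.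
  rewrite pd_scale //; last exact: differentiable_entry.
  congr (_ *: _ + _); first by rewrite pd_entry.
  rewrite (pd_comp k dF (dC a)) scaler_sumr; apply: eq_bigr => b _.
  by rewrite scalerA mulrC.
have PP k l : P k x *m P l x = \sum_a \sum_b (pd l F x 0 a * pd k F x 0 b) *:
    (christoffel G' b (F x) *m christoffel G' a (F x)).
  rewrite exchange_big /= mulmx_suml; apply: eq_bigr => b _.
  rewrite mulmx_sumr; apply: eq_bigr => a _.
  by rewrite -scalemxAl -scalemxAr scalerA mulrC.
(* [W] stands for the term with second derivatives of F, common to both orders; exchanging the
   summation indices aligns the rest. *)
have key (W : 'M[R]_m) (u v : 'rV[R]_m) (C : 'I_m -> 'M[R]_m)
    (E : 'I_m -> 'I_m -> 'M[R]_m) :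
    (W + \sum_a \sum_b (u 0 a * v 0 b) *: E a b)
    - (W + \sum_a \sum_b (v 0 a * u 0 b) *: E a b)
    + \sum_a \sum_b (u 0 a * v 0 b) *: (C b *m C a)
    - \sum_a \sum_b (v 0 a * u 0 b) *: (C b *m C a) =
    \sum_a \sum_b (u 0 a * v 0 b) *:
      (E a b - E b a + C b *m C a - C a *m C b).
  have ex (T : 'I_m -> 'I_m -> 'M[R]_m) :
      \sum_a \sum_b (v 0 a * u 0 b) *: T a b =
      \sum_a \sum_b (u 0 a * v 0 b) *: T b a.
    rewrite exchange_big; apply: eq_bigr => a _; apply: eq_bigr => b _.
    by rewrite mulrC.
  rewrite (ex E) (ex (fun a b => C b *m C a)) opprD addrACA subrr add0r.
  rewrite -!sumrN -!big_split /=; apply: eq_bigr => a _.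
  rewrite -!sumrN -!big_split /=; apply: eq_bigr => b _.
  by rewrite -!scalerN -!scalerDr.
apply: etrans _ (key (\sum_a pd i (pd j F) x 0 a *: christoffel G' a (F x)) _ _
  (fun a => christoffel G' a (F x)) (fun a b => pd a (christoffel G' b) (F x))).
congr (_ - _ + _ - _); [exact: dP| |exact: PP|exact: PP].
by rewrite (pd_swap i j oU sF Ux); exact: dP.
Qed.

Definition isometric_on (R : realType) n m (U : set 'rV[R]_n)
  (G : 'rV[R]_n -> 'M[R]_n) (U' : set 'rV[R]_m) (G' : 'rV[R]_m -> 'M[R]_m)
  (F : 'rV[R]_n -> 'rV[R]_m) : Prop :=
  [/\ metric_on U G, metric_on U' G', smooth_on U F,
      forall x, U x -> U' (F x) &
      forall x, U x ->
        G x = jacobian_mx F x *m G' (F x) *m (jacobian_mx F x)^T].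

(** Covariant derivative of dF as a section of T*N tensor F^*TM; row j is sigma(d_i, d_j). No unit
    normal appears, so this is differentiable in x. *)
Definition second_form (R : realType) n m (G : 'rV[R]_n -> 'M[R]_n)
  (G' : 'rV[R]_m -> 'M[R]_m) (F : 'rV[R]_n -> 'rV[R]_m) (i : 'I_n) x :
  'M[R]_(n, m) :=
  pd i (jacobian_mx F) x + jacobian_mx F x *m pullback_connection G' F i x
  - christoffel G i x *m jacobian_mx F x.

Lemma addmxE (V : nmodType) p q (A B : 'M[V]_(p, q)) i j :
  (A + B) i j = A i j + B i j.
Proof. by rewrite mxE. Qed.

Lemma oppmxE (V : zmodType) p q (A : 'M[V]_(p, q)) i j : (- A) i j = - A i j.
Proof. by rewrite mxE. Qed.

Lemma scalemxE (R : pzRingType) p q (a : R) (A : 'M[R]_(p, q)) i j :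
  (a *: A) i j = a * A i j.
Proof. by rewrite mxE. Qed.

(** The permutation argument behind uniqueness of the Levi-Civita connection: alternating the
    symmetry in the first two indices with the antisymmetry in the last two returns to the same
    entry with the opposite sign. *)
Lemma sym_antisym_eq0 (R : realType) n (T : 'I_n -> 'M[R]_n) :
  (forall i j, row j (T i) = row i (T j)) -> (forall i, (T i)^T = - T i) ->
  forall i, T i = 0.
Proof.
move=> rT aT i; apply/matrixP => j k.
have s a b c : T a b c = T b a c.
  by have /rowP/(_ c) := rT a b; rewrite !mxE.
have t a b c : T a b c = - T a c b.
  by have /matrixP/(_ c b) := aT a; rewrite !mxE.
have : T i j k = - T i j k.
  by rewrite {1}(t i j k) (s i k j) (t k i j) opprK (s k j i) (t j k i) (s j i k).
by rewrite mxE => ?; lra.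
Qed.

Lemma row_second_form_sym (R : realType) n m (U : set 'rV[R]_n)
  (G : 'rV[R]_n -> 'M[R]_n) (U' : set 'rV[R]_m) (G' : 'rV[R]_m -> 'M[R]_m)
  (F : 'rV[R]_n -> 'rV[R]_m) i j x : isometric_on U G U' G' F -> U x ->
  row j (second_form G G' F i x) = row i (second_form G G' F j x).
Proof.
move=> [mG mG' sF UU' _] Ux; have [oU _ _ _] := mG.
have H (a a' b b' c c' : 'M[R]_(n, m)) : row j a = row i a' ->
    row j b = row i b' -> row j c = row i c' ->
    row j (a + b - c) = row i (a' + b' - c').
  by move=> ea eb ec; rewrite !linearB !linearD /= ea eb ec.
apply: H.
- apply: etrans (row_pd_jacobian_mx i j oU sF Ux) _.
  apply: etrans _ (esym (row_pd_jacobian_mx j i oU sF Ux)).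
  exact: pd_swap oU sF Ux.
- rewrite !row_mul !row_jacobian_mx; apply: pullback_torsion_free mG' _.
  exact: UU'.
- apply: etrans (row_mul j _ _) _; apply: etrans _ (esym (row_mul i _ _)).
  congr (_ *m _); apply/rowP => l; rewrite [LHS]mxE [RHS]mxE.
  exact: torsion_free mG Ux.
Qed.

(** Sigma is normal: <sigma(d_i, d_j), d_k> is symmetric in i, j since both connections are torsion
    free, and antisymmetric in j, k since both are metric and G is the induced metric. *)
Lemma gauss_formula (R : realType) n m (U : set 'rV[R]_n)
  (G : 'rV[R]_n -> 'M[R]_n) (U' : set 'rV[R]_m) (G' : 'rV[R]_m -> 'M[R]_m)
  (F : 'rV[R]_n -> 'rV[R]_m) i x : isometric_on U G U' G' F -> U x ->
  second_form G G' F i x *m G' (F x) *m (jacobian_mx F x)^T = 0.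
Proof.
move=> iso Ux; have [mG mG' sF UU' GE] := iso; have [oU _ symG _] := mG.
have dF := smooth_differentiable sF Ux.
have dJ := smooth_differentiable (smooth_jacobian_mx oU sF) Ux.
have [_ sG' symG' _] := mG'; have U'x := UU' _ Ux.
have dG' : differentiable (fun y => G' (F y)) x.
  apply: (@differentiable_comp _ _ _ _ F G') => //.
  exact: smooth_differentiable sG' U'x.
move: i; apply: sym_antisym_eq0 => [i j|i].
  by rewrite !row_mul (row_second_form_sym i j iso Ux).
have := metric_compatible i mG Ux.
have -> : pd i G x = pd i (fun y => jacobian_mx F y *m G' (F y) *m (jacobian_mx F y)^T) x.
  have nU : \forall y \near x, U y by exact: open_nbhs_nbhs.
  by apply: pd_near; near=> y; apply: GE; near: y.
rewrite pd_mulmx; [|exact: differentiable_mulmx|exact: differentiable_tr].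
rewrite (pd_mulmx i dJ dG') (pd_tr i dJ).
rewrite (pullback_metric_compatible i mG' dF U'x) /second_form.
have {}GE := GE _ Ux; have {}symG := symG _ Ux; have {}symG' := symG' _ U'x.
move: (jacobian_mx F x) (pd i (jacobian_mx F) x) (G' (F x)) (christoffel G i x)
  (pullback_connection G' F i x) (G x) GE symG symG'.
move=> D dD g C P g0 g0E sg0 sg E.
have H : (dD + D *m P) *m g *m D^T + ((dD + D *m P) *m g *m D^T)^T =
    C *m g0 + (C *m g0)^T.
  rewrite -E !trmx_mul trmxK (raddfD trmx) /= !trmx_mul sg.
  rewrite !(mulmxDl, mulmxDr) !mulmxA -!addrA; congr (_ + (_ + _)).
  by rewrite addrC.
have -> : (dD + D *m P - C *m D) *m g *m D^T =
    (dD + D *m P) *m g *m D^T - C *m g0.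
  by rewrite !mulmxBl g0E !mulmxA.
move: H; move: (_ *m D^T) (C *m g0) => B0 C0 H.
apply/matrixP => a b; move/matrixP/(_ b a): H; rewrite !mxE; lra.
Unshelve. all: by end_near. Qed.

Lemma differentiable_second_form (R : realType) n m (U : set 'rV[R]_n)
  (G : 'rV[R]_n -> 'M[R]_n) (U' : set 'rV[R]_m) (G' : 'rV[R]_m -> 'M[R]_m)
  (F : 'rV[R]_n -> 'rV[R]_m) i x : isometric_on U G U' G' F -> U x ->
  differentiable (second_form G G' F i) x.
Proof.
move=> [mG mG' sF UU' _] Ux; have [oU _ _ _] := mG.
have sJ := smooth_jacobian_mx oU sF.
have dJ := smooth_differentiable sJ Ux.
apply: differentiableB.
  apply: differentiableD; first exact: smooth_differentiable (smooth_pd i sJ) Ux.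
  apply: differentiable_mulmx => //.
  exact: differentiable_pullback_connection mG' sF Ux (UU' _ Ux).
by apply: differentiable_mulmx => //; exact: differentiable_christoffel mG Ux.
Qed.

(** The noncommutative algebra of [nabla_i, nabla_j] D. The single [dd] is the mixed second
    derivative of D, already identified for both orders. *)
Lemma commutator_expansion (R : comNzRingType) n m
  (D dd di dj : 'M[R]_(n, m)) (Pi Pj dPij dPji : 'M[R]_m)
  (Ci Cj dCij dCji : 'M[R]_n) :
  let Si := di + D *m Pi - Ci *m D in
  let Sj := dj + D *m Pj - Cj *m D in
  let dSij := dd + (di *m Pj + D *m dPij) - (dCij *m D + Cj *m di) in
  let dSji := dd + (dj *m Pi + D *m dPji) - (dCji *m D + Ci *m dj) in
  (dCij - dCji + Cj *m Ci - Ci *m Cj) *m D =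
  D *m (dPij - dPji + Pj *m Pi - Pi *m Pj)
  - (dSij + Sj *m Pi - Ci *m Sj) + (dSji + Si *m Pj - Cj *m Si).
Proof.
move=> Si Sj dSij dSji; rewrite /Si /Sj /dSij /dSji.
rewrite !(mulmxDl, mulmxDr, mulmxN, mulNmx) !mulmxA.
by apply/matrixP => a b; rewrite !(addmxE, oppmxE); ring.
Qed.

(* The tangential part of this identity is the Gauss equation, the normal part
   the Codazzi equation. *)
Lemma second_form_commutator (R : realType) n m (U : set 'rV[R]_n)
  (G : 'rV[R]_n -> 'M[R]_n) (U' : set 'rV[R]_m) (G' : 'rV[R]_m -> 'M[R]_m)
  (F : 'rV[R]_n -> 'rV[R]_m) i j x : isometric_on U G U' G' F -> U x ->
  let D := jacobian_mx F x in
  let S k := second_form G G' F k in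
  let P k := pullback_connection G' F k x in
  let C k := christoffel G k x in
  curvature_mx G i j x *m D =
  D *m (\sum_a \sum_b (pd i F x 0 a * pd j F x 0 b) *: curvature_mx G' a b (F x))
  - (pd i (S j) x + S j x *m P i - C i *m S j x)
  + (pd j (S i) x + S i x *m P j - C j *m S i x).
Proof.
move=> iso Ux D S P C; have [mG mG' sF UU' _] := iso; have [oU _ _ _] := mG.
have sJ := smooth_jacobian_mx oU sF.
have dJ := smooth_differentiable sJ Ux.
have dP k := differentiable_pullback_connection k mG' sF Ux (UU' _ Ux).
have dC k := differentiable_christoffel k mG Ux.
have dS k := differentiable_second_form k iso Ux.
have dpJ k : differentiable (pd k (jacobian_mx F)) x :=
  smooth_differentiable (smooth_pd k sJ) Ux.
have pS k l : pd k (S l) x =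
    pd k (pd l (jacobian_mx F)) x
    + (pd k (jacobian_mx F) x *m P l + D *m pd k (pullback_connection G' F l) x)
    - (pd k (christoffel G l) x *m D + C l *m pd k (jacobian_mx F) x).
  rewrite -(pd_mulmx k dJ (dP l)) -(pd_mulmx k (dC l) dJ).
  rewrite -pdD; [|exact: dpJ|exact: differentiable_mulmx].
  rewrite -pdB //; last exact: differentiable_mulmx.
  by apply: differentiableD => //; exact: differentiable_mulmx.
have <- := pullback_curvature i j mG' oU sF Ux (UU' _ Ux).
rewrite /curvature_mx (pS i j) (pS j i) (pd_swap j i oU sJ Ux).
rewrite /S /second_form -/P -/C -/D.
exact: commutator_expansion.
Qed.

(** Covariant differentiation of <S_j, D> = 0 gives <nabla_i S_j, D> = - <S_j, nabla_i D>, and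
    nabla_i D is S_i. *)
Lemma pd_second_form_tangent (R : realType) n m (U : set 'rV[R]_n)
  (G : 'rV[R]_n -> 'M[R]_n) (U' : set 'rV[R]_m) (G' : 'rV[R]_m -> 'M[R]_m)
  (F : 'rV[R]_n -> 'rV[R]_m) i j x : isometric_on U G U' G' F -> U x ->
  (pd i (second_form G G' F j) x
    + second_form G G' F j x *m pullback_connection G' F i x
    - christoffel G i x *m second_form G G' F j x)
    *m G' (F x) *m (jacobian_mx F x)^T =
  - (second_form G G' F j x *m G' (F x) *m (second_form G G' F i x)^T).
Proof.
move=> iso Ux; have [mG mG' sF UU' _] := iso; have [oU _ _ _] := mG.
have sJ := smooth_jacobian_mx oU sF.
have dJ := smooth_differentiable sJ Ux.
have dF := smooth_differentiable sF Ux.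
have [_ sG' symG' _] := mG'; have U'x := UU' _ Ux.
have dS := differentiable_second_form j iso Ux.
have dG' : differentiable (fun y => G' (F y)) x.
  apply: (@differentiable_comp _ _ _ _ F G') => //.
  exact: smooth_differentiable sG' U'x.
have tan0 : pd i (fun y => second_form G G' F j y *m G' (F y)
    *m (jacobian_mx F y)^T) x = 0.
  rewrite -[RHS](@derive_cst R _ _ 0 x (delta_mx 0 i)).
  have nU : \forall y \near x, U y by exact: open_nbhs_nbhs.
  by apply: pd_near; near=> y; apply: gauss_formula iso _; near: y.
have Sj0 := gauss_formula j iso Ux.
(* Solving the definition of S_i for d_i D makes the connection terms cancel after substitution. *)
have JE : pd i (jacobian_mx F) x = second_form G G' F i x
    - jacobian_mx F x *m pullback_connection G' F i x
    + christoffel G i x *m jacobian_mx F x.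
  by rewrite /second_form addrAC subrK addrK.
move: tan0; rewrite pd_mulmx; [|exact: differentiable_mulmx|exact: differentiable_tr].
rewrite (pd_mulmx i dS dG') (pd_tr i dJ).
rewrite (pullback_metric_compatible i mG' dF U'x) JE.
have {}symG' := symG' _ U'x; move: symG' Sj0.
move: (pd i (second_form G G' F j) x) (second_form G G' F j x)
  (second_form G G' F i x) (jacobian_mx F x) (pullback_connection G' F i x)
  (christoffel G i x) (G' (F x)).
move=> dSj Sj Si D P C g sg Sj0 E; apply/eqP; rewrite -subr_eq0 opprK; apply/eqP.
apply: etrans _ E.
rewrite !(raddfD, raddfN) /= !trmx_mul sg !(mulmxDl, mulmxDr, mulmxN, mulNmx) !mulmxA.
rewrite Sj0 mul0mx addr0 -!(mulmxA C) Sj0 mulmx0 subr0.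
by apply/matrixP => a b; rewrite !(addmxE, oppmxE); ring.
Unshelve. all: by end_near. Qed.

Lemma gauss_equation (R : realType) n m (U : set 'rV[R]_n)
  (G : 'rV[R]_n -> 'M[R]_n) (U' : set 'rV[R]_m) (G' : 'rV[R]_m -> 'M[R]_m)
  (F : 'rV[R]_n -> 'rV[R]_m) i j x : isometric_on U G U' G' F -> U x ->
  let D := jacobian_mx F x in
  let S k := second_form G G' F k x in
  curvature_mx G i j x *m G x =
  D *m (\sum_a \sum_b (pd i F x 0 a * pd j F x 0 b) *: curvature_mx G' a b (F x))
    *m G' (F x) *m D^T
  + S j *m G' (F x) *m (S i)^T - S i *m G' (F x) *m (S j)^T.
Proof.
move=> iso Ux D S; have [_ _ _ _ GE] := iso.
rewrite (GE _ Ux) !mulmxA (second_form_commutator i j iso Ux).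
rewrite [in LHS]mulmxDl [in LHS]mulmxDl mulmxBl mulmxBl.
rewrite (pd_second_form_tangent i j iso Ux) (pd_second_form_tangent j i iso Ux).
by rewrite opprK.
Qed.

(** * Symmetries of the curvature *)

Lemma curvature_mxC (R : realType) n (G : 'rV[R]_n -> 'M[R]_n) i j x :
  curvature_mx G j i x = - curvature_mx G i j x.
Proof.
have H (a b c d : 'M[R]_n) : a - b + c - d = - (b - a + d - c).
  by apply/matrixP => s t; rewrite !mxE; ring.
exact: H.
Qed.

(** Express d_i d_j G through the connection by metric compatibility; equality of the mixed
    derivatives says that the symmetric part of the lowered curvature vanishes. *)
Lemma curvature_mx_antisym (R : realType) n (U : set 'rV[R]_n)
  (G : 'rV[R]_n -> 'M[R]_n) i j x : metric_on U G -> U x ->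
  (curvature_mx G i j x *m G x)^T = - (curvature_mx G i j x *m G x).
Proof.
move=> mG Ux; have [oU sG symG _] := mG.
have dG := smooth_differentiable sG Ux.
have dC k := differentiable_christoffel k mG Ux.
have ddG k l : pd k (pd l G) x =
    (pd k (christoffel G l) x *m G x + christoffel G l x *m pd k G x) +
    (pd k (christoffel G l) x *m G x + christoffel G l x *m pd k G x)^T.
  rewrite -(pd_mulmx k (dC l) dG) -pd_tr; last exact: differentiable_mulmx.
  have dCG : differentiable (fun y => christoffel G l y *m G y) x.
    exact: differentiable_mulmx.
  rewrite -pdD //; last exact: differentiable_tr.
  have nU : \forall y \near x, U y by exact: open_nbhs_nbhs.
  by apply: pd_near; near=> y; apply: metric_compatible mG _; near: y.
have E := pd_swap i j oU sG Ux.
have {}E := etrans (esym (ddG i j)) (etrans E (ddG j i)).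
have gi := metric_compatible i mG Ux; have gj := metric_compatible j mG Ux.
rewrite {}gi {}gj in E; move: E; rewrite /curvature_mx; have := symG _ Ux.
move: (pd i (christoffel G j) x) (pd j (christoffel G i) x) (christoffel G j x)
  (christoffel G i x) (G x).
move=> dij dji Cj Ci g sg.
rewrite !(raddfD, raddfN) /= !trmx_mul sg !(mulmxDl, mulmxDr, mulmxN, mulNmx).
rewrite !(raddfD, raddfN) /= !trmx_mul !trmxK sg !mulmxA => E.
apply/matrixP => a b; move/matrixP/(_ a b): E; rewrite !(addmxE, oppmxE); lra.
Unshelve. all: by end_near. Qed.

Lemma row_pd_christoffel (R : realType) n (U : set 'rV[R]_n)
  (G : 'rV[R]_n -> 'M[R]_n) i j k x : metric_on U G -> U x ->
  row k (pd i (christoffel G j) x) = row j (pd i (christoffel G k) x).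
Proof.
move=> mG Ux; have [oU _ _ _] := mG; apply/rowP => l; rewrite [LHS]mxE [RHS]mxE.
apply: etrans (pd_entry i k l (differentiable_christoffel j mG Ux)) _.
apply: etrans _ (esym (pd_entry i j l (differentiable_christoffel k mG Ux))).
have nU : \forall y \near x, U y by exact: open_nbhs_nbhs.
by apply: pd_near; near=> y; apply: torsion_free mG _; near: y.
Unshelve. all: by end_near. Qed.

Lemma curvature_mx_bianchi (R : realType) n (U : set 'rV[R]_n)
  (G : 'rV[R]_n -> 'M[R]_n) i j k x : metric_on U G -> U x ->
  row k (curvature_mx G i j x) + row i (curvature_mx G j k x)
  + row j (curvature_mx G k i x) = 0.
Proof.
move=> mG Ux.
have rC a b : row a (christoffel G b x) = row b (christoffel G a x).
  apply/rowP => l; rewrite [LHS]mxE [RHS]mxE; exact: torsion_free mG Ux.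
have rdC a b c := row_pd_christoffel a b c mG Ux.
rewrite /curvature_mx.
have H (C : 'I_n -> 'M[R]_n) (dC : 'I_n -> 'I_n -> 'M[R]_n) :
    (forall a b, row a (C b) = row b (C a)) ->
    (forall a b c, row c (dC a b) = row b (dC a c)) ->
    row k (dC i j - dC j i + C j *m C i - C i *m C j)
    + row i (dC j k - dC k j + C k *m C j - C j *m C k)
    + row j (dC k i - dC i k + C i *m C k - C k *m C i) = 0.
  move=> sC sdC; rewrite !(raddfD, raddfN) /= !row_mul.
  rewrite (sC i k) (sC j i) (sC k j) (sdC i j k) (sdC j i k) (sdC k j i).
  by apply/matrixP => a b; rewrite !(addmxE, oppmxE) [RHS]mxE; ring.
exact: (H (fun a => christoffel G a x) (fun a b => pd a (christoffel G b) x)).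
Qed.

(** Integrability condition of nabla J = 0: once the first derivatives of J are replaced by
    connection terms, the commutator of its mixed derivatives is that of J with the curvature. *)
Lemma curvature_mx_parallel (R : realType) n (U : set 'rV[R]_n)
  (G J : 'rV[R]_n -> 'M[R]_n) i j x : metric_on U G -> smooth_on U J ->
  (forall y k, U y -> pd k J y + J y *m christoffel G k y
    - christoffel G k y *m J y = 0) -> U x ->
  curvature_mx G i j x *m J x = J x *m curvature_mx G i j x.
Proof.
move=> mG sJ pJ Ux; have [oU _ _ _] := mG.
have dJ := smooth_differentiable sJ Ux.
have dC k := differentiable_christoffel k mG Ux.
have pdJ k y : U y -> pd k J y = christoffel G k y *m J y - J y *m christoffel G k y.
  move=> Uy; have := pJ y k Uy; move=> /eqP; rewrite -addrA addr_eq0 => /eqP ->.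
  by rewrite opprB.
have ddJ k l : pd k (pd l J) x =
    (pd k (christoffel G l) x *m J x + christoffel G l x *m pd k J x) -
    (pd k J x *m christoffel G l x + J x *m pd k (christoffel G l) x).
  rewrite -(pd_mulmx k (dC l) dJ) -(pd_mulmx k dJ (dC l)).
  rewrite -pdB; [|exact: differentiable_mulmx..].
  have nU : \forall y \near x, U y by exact: open_nbhs_nbhs.
  by apply: pd_near; near=> y; apply: pdJ; near: y.
have E := pd_swap i j oU sJ Ux.
have {}E := etrans (esym (ddJ i j)) (etrans E (ddJ j i)).
rewrite (pdJ i x Ux) (pdJ j x Ux) in E; move: E; rewrite /curvature_mx.
move: (pd i (christoffel G j) x) (pd j (christoffel G i) x) (christoffel G j x)
  (christoffel G i x) (J x).
move=> dij dji Cj Ci g.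
rewrite !(mulmxDl, mulmxDr, mulmxN, mulNmx) !mulmxA => E.
apply/matrixP => a b; move/matrixP/(_ a b): E; rewrite !(addmxE, oppmxE); lra.
Unshelve. all: by end_near. Qed.

(** * Algebraic curvature tensors of constant holomorphic curvature *)

(** T X Y Z W stands for <R(X,Y)Z, W>. Additivity is all that polarization over sums and differences
    requires, and the antisymmetries carry it from slots 1 and 3 to slots 2 and 4. *)
Record curvature_like (R : realFieldType) (V : zmodType)
  (T : V -> V -> V -> V -> R) : Prop := CurvatureLike {
  curv_add : forall X X' Y Z W, T (X + X') Y Z W = T X Y Z W + T X' Y Z W;
  curv_add3 : forall X Y Z Z' W, T X Y (Z + Z') W = T X Y Z W + T X Y Z' W;
  curv_anti12 : forall X Y Z W, T Y X Z W = - T X Y Z W;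
  curv_anti34 : forall X Y Z W, T X Y W Z = - T X Y Z W;
  curv_bianchi : forall X Y Z W, T X Y Z W + T Y Z X W + T Z X Y W = 0 }.

(** The usual combination of the four Bianchi identities obtained by cyclic rotation of the
    arguments. *)
Lemma curv_pair (R : realFieldType) (V : zmodType)
  (T : V -> V -> V -> V -> R) : curvature_like T ->
  forall X Y Z W, T X Y Z W = T Z W X Y.
Proof.
move=> [_ _ a b c] X Y Z W.
have := c X Y Z W; have := c Y Z W X; have := c Z W X Y; have := c W X Y Z.
rewrite (a X Z Y W) (b Y Z X W) (b Z W X Y) (a Y W Z X) (b Y W X Z).
rewrite (a X W Z Y) (b X W Y Z) (b X Z Y W) (a X W Y Z) (b X Y Z W).
lra.
Qed.

Lemma holomorphic_curvature (R : realFieldType) (V : zmodType)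
  (T : V -> V -> V -> V -> R) (g : V -> V -> R) (J : V -> V) (c : R) :
  curvature_like T ->
  (forall X Y Z W, T X Y (J Z) (J W) = T X Y Z W) ->
  (forall X Y Z, g (X + Y) Z = g X Z + g Y Z) ->
  (forall X Y, g X Y = g Y X) ->
  (forall X Y, g (J X) (J Y) = g X Y) ->
  (forall X Y, J (X + Y) = J X + J Y) -> (forall X, J (J X) = - X) ->
  (forall X, T X (J X) (J X) X = 4 * c * g X X ^+ 2) ->
  forall X Y, T X Y Y X = c * (g X X * g Y Y - g X Y ^+ 2 + 3 * g X (J Y) ^+ 2).
Proof.
move=> cT TJ gD gC gJ JD JJ hT.
have pT := curv_pair cT; have [T1 T3 a b bi] := cT.
have T2 X Y Y' Z W : T X (Y + Y') Z W = T X Y Z W + T X Y' Z W.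
  by rewrite a T1 (a X Y) (a X Y') opprD !opprK.
have T4 X Y Z W W' : T X Y Z (W + W') = T X Y Z W + T X Y Z W'.
  by rewrite b T3 (b X Y Z W) (b X Y Z W') opprD !opprK.
have odd0 (f : V -> R) : (forall x y, f (x + y) = f x + f y) ->
    forall x, f (- x) = - f x.
  move=> fD x; apply/eqP; rewrite -addr_eq0 -fD addNr.
  by have := fD 0 0; rewrite addr0 => f0; apply/eqP; lra.
have T1N X Y Z W : T (- X) Y Z W = - T X Y Z W.
  by apply: (odd0 (fun x => T x Y Z W)) => x y; exact: T1.
have T2N X Y Z W : T X (- Y) Z W = - T X Y Z W by rewrite a T1N (a X Y) opprK.
have T3N X Y Z W : T X Y (- Z) W = - T X Y Z W by rewrite pT T1N pT.
have T4N X Y Z W : T X Y Z (- W) = - T X Y Z W by rewrite pT T2N pT.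
have g2D X Y Z : g Z (X + Y) = g Z X + g Z Y by rewrite gC gD (gC X) (gC Y).
have gN X Z : g (- X) Z = - g X Z.
  by apply: (odd0 (fun x => g x Z)) => x y; exact: gD.
have g2N X Z : g Z (- X) = - g Z X by rewrite gC gN gC.
have JN X : J (- X) = - J X by rewrite -[X in J (- X)]opprK -JJ opprK -!JJ.
(* Combining the hypothesis at X + Y and X - Y removes the terms odd in Y. Six terms quadratic in Y
   remain; the names [t24], [t13], ... record the slots that hold Y. Invariance under J, pair
   symmetry and Bianchi reduce them to T(X,JY,JY,X) and T(X,Y,Y,X). *)
have key X Y : 3 * T X (J Y) (J Y) X + T X Y Y X =
    4 * c * (g X X * g Y Y + 2 * g X Y ^+ 2).
  have E1 := hT (X + Y); have E2 := hT (X - Y).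
  rewrite !(JD, JN, T1, T2, T3, T4, T1N, T2N, T3N, T4N, gD, g2D, gN, g2N) in E1 E2.
  rewrite (gC Y X) !hT in E1 E2.
  have t24 : T X (J Y) (J X) Y = T X (J Y) (J Y) X.
    by rewrite -TJ JJ T3N b opprK.
  have t13 : T Y (J X) (J Y) X = T X (J Y) (J Y) X.
    by rewrite pT -TJ JJ T4N (a X) opprK.
  have t14 : T Y (J X) (J X) Y = T X (J Y) (J Y) X.
    by rewrite -t24 (pT Y) -(TJ (J X)) JJ T4N (pT X) (b (J X) Y (J Y) X).
  have t34 : T X (J X) (J Y) Y = T X (J Y) (J Y) X + T X Y Y X.
    have := bi X (J X) (J Y) Y; rewrite (a X (J Y) (J X) Y) t24.
    by rewrite (pT (J X) (J Y)) TJ (b X Y Y X) => ?; lra.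
  have t12 : T Y (J Y) (J X) X = T X (J X) (J Y) Y.
    by rewrite pT a b opprK.
  rewrite t13 t14 t12 t34 t24 in E1 E2.
  lra.
(* Replacing Y by JY swaps the two unknowns, so two linear equations determine T(X,Y,Y,X). *)
move=> X Y; have k1 := key X Y; have k2 := key X (J Y).
rewrite JJ T2N T3N opprK gJ in k2.
lra.
Qed.

(** * Inner products and curvature operators in components *)

Lemma innerDl (R : realType) n (g : 'M[R]_n) u v w :
  inner g (u + v) w = inner g u w + inner g v w.
Proof. by rewrite /inner !mulmxDl mxE. Qed.

Lemma innerDr (R : realType) n (g : 'M[R]_n) u v w :
  inner g w (u + v) = inner g w u + inner g w v.
Proof. by rewrite /inner linearD /= mulmxDr mxE. Qed.

Lemma innerZl (R : realType) n (g : 'M[R]_n) a u w :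
  inner g (a *: u) w = a * inner g u w.
Proof. by rewrite /inner -!scalemxAl mxE. Qed.

Lemma innerZr (R : realType) n (g : 'M[R]_n) a u w :
  inner g w (a *: u) = a * inner g w u.
Proof. by rewrite /inner linearZ /= -scalemxAr mxE. Qed.

Lemma innerC (R : realType) n (g : 'M[R]_n) u v :
  g^T = g -> inner g u v = inner g v u.
Proof.
move=> sg; rewrite /inner -[u *m g *m v^T]trmxK mxE !trmx_mul trmxK sg.
by rewrite mulmxA.
Qed.

Lemma inner_mulmx (R : realType) n m (g : 'M[R]_m) (D : 'M[R]_(n, m)) u v :
  inner g (u *m D) (v *m D) = inner (D *m g *m D^T) u v.
Proof. by rewrite /inner trmx_mul !mulmxA. Qed.

(** Matrix of Z |-> R(X,Y)Z. The coefficients [K] are abstract so that the same algebra serves the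
    hypersurface and the ambient space. *)
Definition curvature_op (R : realType) n (K : 'I_n -> 'I_n -> 'M[R]_n)
  (X Y : 'rV[R]_n) : 'M[R]_n := \sum_i \sum_j (X 0 i * Y 0 j) *: K i j.

Lemma curvatureE (R : realType) n (G : 'rV[R]_n -> 'M[R]_n) x X Y Z :
  curvature G x X Y Z = Z *m curvature_op (fun i j => curvature_mx G i j x) X Y.
Proof.
rewrite /curvature /curvature_op mulmx_sumr; apply: eq_bigr => i _.
by rewrite mulmx_sumr; apply: eq_bigr => j _; rewrite scalemxAr.
Qed.

Lemma curvature_opDl (R : realType) n (K : 'I_n -> 'I_n -> 'M[R]_n) X X' Y :
  curvature_op K (X + X') Y = curvature_op K X Y + curvature_op K X' Y.
Proof.
rewrite -big_split; apply: eq_bigr => i _; rewrite -big_split /=.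
by apply: eq_bigr => j _; rewrite mxE mulrDl scalerDl.
Qed.

Lemma curvature_op_delta (R : realType) n (K : 'I_n -> 'I_n -> 'M[R]_n) i Y :
  curvature_op K (delta_mx 0 i) Y = \sum_j Y 0 j *: K i j.
Proof.
rewrite /curvature_op (bigD1 i) //= [X in _ + X]big1 ?addr0 => [|k ki].
  by apply: eq_bigr => j _; rewrite mxE !eqxx mul1r.
by apply: big1 => j _; rewrite mxE (negPf ki) andbF mul0r scale0r.
Qed.

Lemma curvature_op_anti (R : realType) n (K : 'I_n -> 'I_n -> 'M[R]_n) X Y :
  (forall i j, K j i = - K i j) -> curvature_op K Y X = - curvature_op K X Y.
Proof.
move=> aK; rewrite /curvature_op exchange_big -sumrN; apply: eq_bigr => i _.
rewrite -sumrN; apply: eq_bigr => j _.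
by rewrite aK scalerN mulrC.
Qed.

Lemma curvature_op_tr (R : realType) n (K : 'I_n -> 'I_n -> 'M[R]_n) g X Y :
  (forall i j, (K i j *m g)^T = - (K i j *m g)) ->
  (curvature_op K X Y *m g)^T = - (curvature_op K X Y *m g).
Proof.
move=> aK; rewrite mulmx_suml !raddf_sum; apply: eq_bigr => i _.
rewrite mulmx_suml !raddf_sum; apply: eq_bigr => j _.
by rewrite -scalemxAl /= linearZ /= aK scalerN.
Qed.

Lemma mulmx_curvature_op (R : realType) n (K : 'I_n -> 'I_n -> 'M[R]_n) X Y Z :
  Z *m curvature_op K X Y =
  \sum_i \sum_j \sum_k (X 0 i * Y 0 j * Z 0 k) *: row k (K i j).
Proof.
rewrite mulmx_sumr; apply: eq_bigr => i _; rewrite mulmx_sumr.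
apply: eq_bigr => j _; rewrite -scalemxAr [in LHS](row_sum_delta Z) mulmx_suml.
rewrite scaler_sumr; apply: eq_bigr => k _.
by rewrite -scalemxAl scalerA rowE.
Qed.

Lemma curvature_op_bianchi (R : realType) n (K : 'I_n -> 'I_n -> 'M[R]_n) X Y Z :
  (forall i j k, row k (K i j) + row i (K j k) + row j (K k i) = 0) ->
  Z *m curvature_op K X Y + X *m curvature_op K Y Z + Y *m curvature_op K Z X = 0.
Proof.
move=> bK; rewrite !mulmx_curvature_op.
have -> : \sum_i \sum_j \sum_k (Y 0 i * Z 0 j * X 0 k) *: row k (K i j) =
    \sum_i \sum_j \sum_k (X 0 i * Y 0 j * Z 0 k) *: row i (K j k).
  rewrite (eq_bigr (fun i => \sum_k \sum_j (Y 0 i * Z 0 j * X 0 k) *: row k (K i j))).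
    rewrite exchange_big; apply: eq_bigr => i _; apply: eq_bigr => j _.
    by apply: eq_bigr => k _; congr (_ *: _); ring.
  by move=> i _; rewrite exchange_big.
have -> : \sum_i \sum_j \sum_k (Z 0 i * X 0 j * Y 0 k) *: row k (K i j) =
    \sum_i \sum_j \sum_k (X 0 i * Y 0 j * Z 0 k) *: row j (K k i).
  rewrite exchange_big; apply: eq_bigr => i _; rewrite exchange_big.
  by apply: eq_bigr => j _; apply: eq_bigr => k _; congr (_ *: _); ring.
rewrite -!big_split big1 //= => i _; rewrite -!big_split big1 //= => j _.
rewrite -!big_split big1 //= => k _.
by rewrite -!scalerDr bK scaler0.
Qed.

Lemma curvature_like_op (R : realType) n (K : 'I_n -> 'I_n -> 'M[R]_n) g :
  (forall i j, K j i = - K i j) ->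
  (forall i j, (K i j *m g)^T = - (K i j *m g)) ->
  (forall i j k, row k (K i j) + row i (K j k) + row j (K k i) = 0) ->
  curvature_like (fun X Y Z W => inner g (Z *m curvature_op K X Y) W).
Proof.
move=> aK tK bK; split=> [X X' Y Z W|X Y Z Z' W|X Y Z W|X Y Z W|X Y Z W].
- by rewrite curvature_opDl mulmxDr innerDl.
- by rewrite mulmxDl innerDl.
- by rewrite (curvature_op_anti _ _ aK) mulmxN -scaleN1r innerZl mulN1r.
- have E u v (A : 'M[R]_n) : (u *m A *m v^T) 0 0 = (v *m A^T *m u^T) (0 : 'I_1) (0 : 'I_1).
    by rewrite -[u *m A *m v^T]trmxK mxE !trmx_mul trmxK mulmxA.
  rewrite /inner -(mulmxA W) E (curvature_op_tr _ _ tK) mulmxN mulNmx mxE.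
  by rewrite (mulmxA Z).
by rewrite -!innerDl curvature_op_bianchi // /inner !mul0mx mxE.
Qed.

(** * Curvature of a real hypersurface of a complex space form *)

(** <u, Ju> = <Ju, JJu> = - <Ju, u>. *)
Lemma inner_complex_orthogonal (R : realType) n (g J : 'M[R]_n) u :
  g^T = g -> J *m J = - 1%:M -> J *m g *m J^T = g -> inner g u (u *m J) = 0.
Proof.
move=> sg JJ Jg.
have : inner g u (u *m J) = - inner g u (u *m J).
  rewrite -{1}Jg -inner_mulmx -mulmxA JJ mulmxN mulmx1 -scaleN1r innerZr mulN1r.
  by rewrite innerC.
by move=> ?; lra.
Qed.

Lemma space_form_curvature (R : realType) n (U : set 'rV[R]_n)
  (G J : 'rV[R]_n -> 'M[R]_n) (c : R) x :
  metric_on U G -> smooth_on U J ->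
  (forall y k, U y -> pd k J y + J y *m christoffel G k y
    - christoffel G k y *m J y = 0) -> U x ->
  (forall u, u != 0 -> 0 < inner (G x) u u) ->
  J x *m J x = - 1%:M -> J x *m G x *m (J x)^T = G x ->
  (forall X, X != 0 -> sectional G x X (X *m J x) = 4 * c) ->
  curvature_like (fun X Y Z W => inner (G x) (curvature G x X Y Z) W) /\
  forall X Y, inner (G x) (curvature G x X Y Y) X =
   c * (inner (G x) X X * inner (G x) Y Y - inner (G x) X Y ^+ 2
        + 3 * inner (G x) X (Y *m J x) ^+ 2).
Proof.
move=> mG sJ pJ Ux posG JJ JG sec; have [oU sG symG _] := mG.
have sg := symG _ Ux.
pose K i j := curvature_mx G i j x.
have cE X Y Z : curvature G x X Y Z = Z *m curvature_op K X Y by exact: curvatureE.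
have KJ X Y : curvature_op K X Y *m J x = J x *m curvature_op K X Y.
  rewrite mulmx_suml mulmx_sumr; apply: eq_bigr => i _.
  rewrite mulmx_suml mulmx_sumr; apply: eq_bigr => j _.
  rewrite -scalemxAl -scalemxAr; congr (_ *: _).
  exact: curvature_mx_parallel mG sJ pJ Ux.
have cl : curvature_like (fun X Y Z W => inner (G x) (Z *m curvature_op K X Y) W).
  apply: curvature_like_op => [i j|i j|i j k]; first exact: curvature_mxC.
    exact: curvature_mx_antisym mG Ux.
  exact: curvature_mx_bianchi mG Ux.
split.
  by case: cl => *; split=> *; rewrite !cE.
move=> X Y; rewrite cE.
apply: (holomorphic_curvature (T := fun X Y Z W =>
  inner (G x) (Z *m curvature_op K X Y) W) (g := inner (G x))
  (J := fun X => X *m J x)) => //.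
- move=> {}X {}Y Z W.
  by rewrite -mulmxA -KJ mulmxA inner_mulmx JG.
- by move=> *; exact: innerDl.
- by move=> *; exact: innerC.
- by move=> *; rewrite inner_mulmx JG.
- by move=> *; exact: mulmxDl.
- by move=> Z; rewrite -mulmxA JJ mulmxN mulmx1.
move=> {}X; have [->|X0] := eqVneq X 0.
  by rewrite /inner !mul0mx !mxE expr0n mulr0.
have := sec X X0; rewrite /sectional inner_complex_orthogonal // cE.
(* As <X, JX> = 0 and |JX| = |X|, the denominator of the sectional curvature is |X|^4. *)
rewrite inner_mulmx JG expr0n subr0 => <-.
by rewrite expr2 divfK // mulf_neq0 // gt_eqF // posG.
Qed.

(** Invertibility of D g D^T forces g D^T to have rank n, so its kernel, the normal space, has
    dimension (n + 1) - n = 1 and is spanned by xi. *)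
Lemma normal_line (R : realType) n (D : 'M[R]_(n, n.+1)) (g : 'M[R]_n.+1)
  (xi v : 'rV[R]_n.+1) :
  D *m g *m D^T \in unitmx -> inner g xi xi = 1 -> xi *m g *m D^T = 0 ->
  v *m g *m D^T = 0 -> v = inner g v xi *: xi.
Proof.
move=> uG xi1 xi0 v0.
have xin0 : xi != 0.
  by apply/eqP => E; move: xi1; rewrite E /inner !mul0mx mxE => /eqP; rewrite eq_sym oner_eq0.
have rD : \rank (g *m D^T) = n.
  apply/eqP; rewrite eqn_leq rank_leq_col /=.
  by rewrite -[X in (X <= _)%N](mxrank_unit uG) -mulmxA mxrankS // submxMl.
have rK : \rank (kermx (g *m D^T)) = 1%N by rewrite mxrank_ker rD subSnn.
have sub_xi : (xi <= kermx (g *m D^T))%MS by apply/sub_kermxP; rewrite mulmxA.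
have sub_v : (v <= kermx (g *m D^T))%MS by apply/sub_kermxP; rewrite mulmxA.
have : (kermx (g *m D^T) <= xi)%MS.
  by rewrite -(geq_leqif (mxrank_leqif_sup sub_xi)) rK rank_rV xin0.
move=> /(submx_trans sub_v)/sub_rVP[a ->].
by rewrite innerZl xi1 mulr1.
Qed.

(** With v the covector <AY, .>, [v *m invmx g] is AY, a is <AY,Y> and z is AY - aY; as |Y| = 1,
    |z|^2 = |AY|^2 - a^2. *)
Lemma normal_ricci_defect (R : realType) n (g : 'M[R]_n) (Y v : 'rV[R]_n) (t a : R) :
  g^T = g -> g \in unitmx -> inner g Y Y = 1 -> a = (v *m Y^T) 0 0 ->
  let z := v *m invmx g - a *: Y in
  t ^+ 2 / 2 - (t * a - (v *m invmx g *m v^T) 0 0) =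
  ((t - a) ^+ 2 + a ^+ 2) / 2 + inner g z z.
Proof.
move=> sg ug Y1 aE z.
have sgi : (invmx g)^T = invmx g by rewrite trmx_inv sg.
have e1 : inner g (v *m invmx g) (v *m invmx g) = (v *m invmx g *m v^T) 0 0.
  by rewrite /inner mulmxKV // trmx_mul sgi mulmxA.
have e2 : inner g (v *m invmx g) Y = a by rewrite /inner mulmxKV // -aE.
have e3 : inner g Y (v *m invmx g) = a by rewrite innerC.
rewrite /z -scaleNr !innerDl !innerDr !innerZl !innerZr e1 e2 e3 Y1.
by field.
Qed.

Lemma row_lin1_mx (R : realType) n (f : 'rV[R]_n -> 'rV[R]_n) i :
  row i (lin1_mx f) = f (delta_mx 0 i).
Proof. by apply/rowP => j; rewrite !mxE. Qed.

Lemma curvature_op_mulmx (R : realType) n m (K : 'I_m -> 'I_m -> 'M[R]_m) X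
  (Y : 'rV[R]_n) (D : 'M[R]_(n, m)) :
  curvature_op K X (Y *m D) = \sum_j Y 0 j *: curvature_op K X (row j D).
Proof.
rewrite /curvature_op; under [RHS]eq_bigr do rewrite scaler_sumr.
rewrite [RHS]exchange_big; apply: eq_bigr => a _ /=.
under [RHS]eq_bigr do rewrite scaler_sumr.
rewrite [RHS]exchange_big; apply: eq_bigr => b _ /=.
rewrite mxE mulr_sumr scaler_suml; apply: eq_bigr => j _.
by rewrite mxE scalerA; congr (_ *: _); ring.
Qed.

(** By pair symmetry T(., y, y, .) is symmetric and biadditive, hence determined by its diagonal.
    Only the three vectors X, Z, X + Z are assumed on the diagonal, since the formula will be
    available for tangent vectors alone. *)
Lemma curvature_polar (R : realFieldType) (V : zmodType)
  (T : V -> V -> V -> V -> R) (q : V -> V -> R) (y X Z : V) :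
  curvature_like T ->
  (forall u v w, q (u + v) w = q u w + q v w) -> (forall u v, q u v = q v u) ->
  T X y y X = q X X -> T Z y y Z = q Z Z -> T (X + Z) y y (X + Z) = q (X + Z) (X + Z) ->
  T X y y Z = q X Z.
Proof.
move=> cT qD qC TX TZ; have pT := curv_pair cT; have [T1 _ a b _] := cT.
have T4 u v w s t : T u v w (s + t) = T u v w s + T u v w t.
  by rewrite pT -[LHS]opprK -a T1 opprD -!a -!(pT u v w).
have qD2 u v w : q w (u + v) = q w u + q w v by rewrite qC qD (qC u) (qC v).
have TC : T Z y y X = T X y y Z by rewrite pT a b opprK.
rewrite T1 !T4 qD !qD2 TX TZ TC (qC Z X) => ?; lra.
Qed.

(** The Gauss equation contracted for the Jacobi operator, with S_i = b_i xi: the extra terms are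
    <AY,Y> A d_i - <A d_i,Y> AY, lowered by the metric. *)
Lemma gauss_ricci_mx (R : realType) n (D : 'M[R]_(n, n.+1)) (g : 'M[R]_n.+1)
  (G : 'M[R]_n) (K : 'I_n -> 'I_n -> 'M[R]_n)
  (K' : 'I_n.+1 -> 'I_n.+1 -> 'M[R]_n.+1) (S : 'I_n -> 'M[R]_(n, n.+1))
  (xi y : 'rV[R]_n.+1) (Y : 'rV[R]_n) (b : 'M[R]_n) i :
  (forall i j, K i j *m G = D *m curvature_op K' (row i D) (row j D) *m g *m D^T
     + S j *m g *m (S i)^T - S i *m g *m (S j)^T) ->
  inner g xi xi = 1 -> y = Y *m D -> b^T = b ->
  (forall i, S i = (row i b)^T *m xi) ->
  Y *m curvature_op K (delta_mx 0 i) Y *m G =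
  y *m curvature_op K' (row i D) y *m g *m D^T
  + (Y *m b *m Y^T) 0 0 *: row i b - (Y *m b) 0 i *: (Y *m b).
Proof.
move=> gauss xi1 -> sb SE.
have xiM : xi *m g *m xi^T = 1%:M by apply/rowP => k; rewrite ord1 [RHS]mxE -xi1.
have SS k l : S k *m g *m (S l)^T = (row k b)^T *m row l b.
  rewrite !SE trmx_mul trmxK !mulmxA -(mulmxA _ xi g) -(mulmxA _ _ xi^T) xiM.
  by rewrite mulmx1.
have Yr k : Y *m (row k b)^T = ((Y *m b) 0 k)%:M.
  apply/rowP => l; rewrite ord1 [LHS]mxE [RHS]mxE eqxx mulr1n mxE.
  by apply: eq_bigr => j _; rewrite -{2}sb !mxE.
rewrite curvature_op_delta curvature_op_mulmx -mulmxA.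
rewrite mulmx_suml mulmx_sumr mulmx_sumr 2!mulmx_suml.
have -> : (Y *m b *m Y^T) 0 0 *: row i b = \sum_j Y 0 j *: ((Y *m b) 0 j *: row i b).
  rewrite mxE scaler_suml; apply: eq_bigr => j _.
  by rewrite scalerA [Y^T _ _]mxE mulrC.
have -> : (Y *m b) 0 i *: (Y *m b) = \sum_j Y 0 j *: ((Y *m b) 0 i *: row j b).
  rewrite [X in _ *: X](mulmx_sum_row Y b) scaler_sumr; apply: eq_bigr => j _.
  by rewrite !scalerA mulrC.
rewrite -sumrN -!big_split /=; apply: eq_bigr => j _.
rewrite -!scalemxAl -!scalemxAr -!scalemxAl -scalerN -!scalerDr; congr (_ *: _).
rewrite gauss !mulmxDr !SS mulmxN !mulmxA !Yr !mul_scalar_mx.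
by [].
Qed.

Lemma inner_row (R : realType) n m (D : 'M[R]_(n, m)) (g : 'M[R]_m) u i :
  inner g u (row i D) = (u *m g *m D^T) 0 i.
Proof.
rewrite /inner [LHS]mxE [RHS]mxE; apply: eq_bigr => j _; congr (_ * _).
by rewrite !mxE.
Qed.

Lemma mxtrace_rank1 (R : realType) n (w : 'rV[R]_n) (A : 'M[R]_n) :
  \tr (w^T *m w *m A) = (w *m A *m w^T) 0 0.
Proof. by rewrite -mulmxA mxtrace_mulC trace_mx11. Qed.

Lemma hypersurface_ricci (R : realType) n (U : set 'rV[R]_n)
  (G : 'rV[R]_n -> 'M[R]_n) (U' : set 'rV[R]_n.+1)
  (G' : 'rV[R]_n.+1 -> 'M[R]_n.+1) (F : 'rV[R]_n -> 'rV[R]_n.+1) x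
  (xi : 'rV[R]_n.+1) (J : 'M[R]_n.+1) (Y : 'rV[R]_n) c :
  let D := jacobian_mx F x in
  let g := G' (F x) in
  let b := \matrix_(i, k) inner g (row k (second_form G G' F i x)) xi in
  let v := Y *m b in
  isometric_on U G U' G' F -> U x ->
  curvature_like (fun X Y Z W => inner g (curvature G' (F x) X Y Z) W) ->
  (forall X Y, inner g (curvature G' (F x) X Y Y) X =
   c * (inner g X X * inner g Y Y - inner g X Y ^+ 2
        + 3 * inner g X (Y *m J) ^+ 2)) ->
  J *m J = - 1%:M -> J *m g *m J^T = g ->
  inner g xi xi = 1 -> xi *m g *m D^T = 0 -> Y *m D = xi *m J ->
  [/\ (forall i k, row k (second_form G G' F i x) = b i k *: xi),
      inner (G x) Y Y = 1, b^T = b &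
  ricci G x Y Y = c * (n%:R - 1) + \tr (b *m invmx (G x)) * (v *m Y^T) 0 0
    - (v *m invmx (G x) *m v^T) 0 0].
Proof.
move=> D g b v iso Ux cl hc JJ Jg xi1 xi0 YD.
have [mG mG' sF UU' GE] := iso; have uG : G x \in unitmx by case: mG => _ _ _; apply.
have sG : (G x)^T = G x by case: mG => _ _ + _; apply.
have sg : g^T = g by case: mG' => _ _ + _; apply; exact: UU'.
have GxE : G x = D *m g *m D^T := GE _ Ux.
have normal i k : row k (second_form G G' F i x) = b i k *: xi.
  rewrite [b i k]mxE; apply: (@normal_line _ _ D) => //; first by rewrite -GxE.
  by rewrite -!row_mul (gauss_formula i iso Ux) row0.
have SE i : second_form G G' F i x = (row i b)^T *m xi.
  apply/row_matrixP => k; rewrite normal row_mul; apply/rowP => l.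
  by rewrite !mxE big_ord1 !mxE.
have sb : b^T = b.
  by apply/matrixP => i k; rewrite !mxE (row_second_form_sym k i iso Ux).
have Y1 : inner (G x) Y Y = 1 by rewrite GxE -inner_mulmx YD inner_mulmx Jg.
split => //.
pose K i j := curvature_mx G i j x.
pose K' i j := curvature_mx G' i j (F x).
pose y := Y *m D.
have yy : inner g y y = 1 by rewrite inner_mulmx -GxE.
have gaussK i j : K i j *m G x =
    D *m curvature_op K' (row i D) (row j D) *m g *m D^T
    + second_form G G' F j x *m g *m (second_form G G' F i x)^T
    - second_form G G' F i x *m g *m (second_form G G' F j x)^T.
  by rewrite !row_jacobian_mx; exact: gauss_equation iso Ux.
have c'E X Y' Z : curvature G' (F x) X Y' Z = Z *m curvature_op K' X Y'.
  exact: curvatureE.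
have tangent i : inner g (row i D) xi = 0.
  by rewrite innerC // inner_row xi0 mxE.
(* JY = -xi is normal, which removes the term 3 <X,JY>^2 for tangent X. *)
have yJ : y *m J = - xi by rewrite /y YD -mulmxA JJ mulmxN mulmx1.
have ambient X : inner g X xi = 0 -> inner g (y *m curvature_op K' X y) X =
    c * (inner g X X - inner g X y * inner g X y).
  move=> X0; rewrite -c'E hc yy yJ -(scaleN1r xi) innerZr X0; ring.
have amb i k : inner g (y *m curvature_op K' (row i D) y) (row k D) =
    c * (G x i k - (Y *m G x) 0 i * (Y *m G x) 0 k).
  have Dy l : inner g (row l D) y = (Y *m G x) 0 l.
    by rewrite innerC // inner_row /y GxE !mulmxA.
  have DD : inner g (row i D) (row k D) = G x i k.
    by rewrite inner_row GxE -!row_mul mxE.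
  rewrite -!Dy -DD.
  apply: (curvature_polar (T := fun X Y Z W => inner g (Z *m curvature_op K' X Y) W)
    (q := fun u w => c * (inner g u w - inner g u y * inner g w y))).
  - by case: cl => *; split=> *; rewrite -!c'E.
  - by move=> *; rewrite !innerDl; ring.
  - by move=> *; rewrite innerC // [X in _ - X]mulrC.
  - by apply: ambient; rewrite tangent.
  - by apply: ambient; rewrite tangent.
  - by apply: ambient; rewrite innerDl !tangent addr0.
(* The lowered Jacobi operator X |-> R(X,Y)Y; multiplying by the inverse metric and taking the trace
   gives Ric(Y,Y). *)
have LG : lin1_mx (fun X => curvature G x X Y Y) *m G x =
    c *: (G x - (Y *m G x)^T *m (Y *m G x)) + (v *m Y^T) 0 0 *: b - v^T *m v.
  apply/row_matrixP => i.
  rewrite row_mul row_lin1_mx curvatureE.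
  rewrite (gauss_ricci_mx (y := y) i gaussK xi1 erefl sb SE).
  apply/rowP => k; rewrite [RHS]mxE !(addmxE, oppmxE, scalemxE) -(inner_row D) amb.
  rewrite [row i b 0 k]mxE.
  have -> : (v^T *m v) i k = v 0 i * v 0 k by rewrite mxE big_ord1 mxE.
  have -> : ((Y *m G x)^T *m (Y *m G x)) i k = (Y *m G x) 0 i * (Y *m G x) 0 k.
    by rewrite mxE big_ord1 mxE.
  by [].
rewrite /ricci -[lin1_mx _](mulmxK uG) LG mulmxDl mulNmx mulmxDl.
rewrite -!scalemxAl mulmxBl mulmxV // mxtraceD mxtraceD mxtraceZ mxtraceZ.
rewrite !raddfN raddfD /= raddfN /= mxtrace1 !mxtrace_rank1 mulmxK //.
have -> : (Y *m (Y *m G x)^T) 0 0 = 1 by rewrite trmx_mul sG mulmxA -Y1.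
by rewrite mulrC [X in _ + X - _]mulrC.
Qed.

(** * Passage from charts to manifolds *)

(** The image is the preimage of W under [cinv], which is continuous on the open image of the
    chart. *)
Lemma chart_open_image (R : realType) (M : topologicalType) n
  (a : chart R M n) (W : set M) : open W -> open (a @` (cdom a `&` W)).
Proof.
move=> oW.
have ci : {in a @` cdom a, continuous (cinv a)}.
  rewrite -continuous_open_subspace; first exact: cinv_continuous.
  exact: cimg_open.
have -> : a @` (cdom a `&` W) = a @` cdom a `&` cinv a @^-1` W.
  apply/seteqP; split => [_ [q [aq Wq] <-]|_ [[q aq <-]]].
    by split; [exists q|rewrite /preimage /= cmapK].
  by rewrite /preimage /= cmapK // => Wq; exists q.
rewrite openE => y [Ay Wy]; apply: filterI.
  by apply: open_nbhs_nbhs; split; [exact: cimg_open|].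
by apply: (ci y); [exact: mem_set|apply: open_nbhs_nbhs; split].
Qed.

Lemma posdef_unitmx (R : realType) n (g : 'M[R]_n) :
  (forall u, u != 0 -> 0 < inner g u u) -> g \in unitmx.
Proof.
move=> pos; rewrite -row_free_unit -kermx_eq0; apply/eqP/row_matrixP => i.
rewrite row0; apply/eqP; apply: contraT => /pos.
have /sub_kermxP E := row_sub i (kermx g).
by rewrite /inner E mul0mx mxE ltxx.
Qed.

Lemma metric_on_chart (R : realType) n (M : riemannian R n) (a : chart R M n) :
  atlas a -> metric_on (a @` cdom a) (metric a).
Proof.
move=> aa; split; [exact: cimg_open|exact: metric_smooth| |].
  by move=> _ [q aq <-]; exact: (Defs.metric_sym aa aq).
by move=> _ [q aq <-]; apply: posdef_unitmx; exact: (Defs.metric_pos aa aq).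
Qed.

(** The chart is cut down to the points that f sends into the target chart; continuity of f keeps
    this domain open. *)
Lemma isometric_immersion_on (R : realType) n m (N : riemannian R n)
  (M : riemannian R m) (f : N -> M) (a : chart R N n) (b : chart R M m) :
  isometric_immersion f -> atlas a -> atlas b ->
  isometric_on (a @` (cdom a `&` f @^-1` cdom b)) (metric a) (b @` cdom b)
    (metric b) (b \o f \o cinv a).
Proof.
move=> [cf H] aa ab; have [sF isoF] := H a b aa ab.
have oW : open (f @^-1` cdom b) by move/continuousP : cf; apply; exact: cdom_open.
split => //.
- apply: metric_on_sub (metric_on_chart aa); first exact: chart_open_image.
  by move=> _ [q [aq _] <-]; exists q.
- exact: metric_on_chart.
- by move=> _ [q [aq bq] <-]; exists (f q) => //=; rewrite cmapK.
move=> _ [q [aq bq] <-]; rewrite isoF //= cmapK //.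
rewrite jacobian_mxE //; apply: (smooth_differentiable sF).
by exists q.
Qed.

Definition second_form_at (R : realType) n m (N : riemannian R n)
  (M : riemannian R m) (f : N -> M) (p : N) (i : 'I_n) : 'M[R]_(n, m) :=
  second_form (metric (chart_at p)) (metric (chart_at (f p))) (local_expr f p)
    i (chart_at p p).

Definition normal_form (R : realType) n m (N : riemannian R n)
  (M : riemannian R m) (f : N -> M) (p : N) (xi : tangent (f p)) : 'M[R]_n :=
  \matrix_(i, k) inner (metric_at (f p)) (row k (second_form_at f p i)) xi.

Lemma inner_sum (R : realType) n (g : 'M[R]_n) (I : finType) (u : I -> 'rV[R]_n) w :
  inner g (\sum_i u i) w = \sum_i inner g (u i) w.
Proof. by rewrite /inner !mulmx_suml summxE. Qed.

Lemma metric_at_pos (R : realType) n (M : riemannian R n) (p : M) u :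
  u != 0 -> 0 < inner (metric_at p) u u.
Proof. exact: (Defs.metric_pos (chart_at_atlas p) (chart_at_dom p)). Qed.

Lemma metric_at_sym (R : realType) n (M : riemannian R n) (p : M) :
  (metric_at p)^T = metric_at p.
Proof. exact: (Defs.metric_sym (chart_at_atlas p) (chart_at_dom p)). Qed.

Lemma isometric_on_chart_at (R : realType) n m (N : riemannian R n)
  (M : riemannian R m) (f : N -> M) (p : N) : isometric_immersion f ->
  exists U, [/\ isometric_on U (metric (chart_at p))
    (chart_at (f p) @` cdom (chart_at (f p))) (metric (chart_at (f p)))
    (local_expr f p), U (chart_at p p) &
    local_expr f p (chart_at p p) = chart_at (f p) (f p)].
Proof.
move=> iso; exists (chart_at p @` (cdom (chart_at p) `&` f @^-1` cdom (chart_at (f p)))).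
split; first exact: isometric_immersion_on iso (chart_at_atlas p) (chart_at_atlas (f p)).
  by exists p => //; split; exact: chart_at_dom.
by rewrite /local_expr /= cmapK //; exact: chart_at_dom.
Qed.

Lemma sff_basisE (R : realType) n m (N : riemannian R n)
  (M : riemannian R m) (f : N -> M) (p : N) i j : isometric_immersion f ->
  sff_basis f p i j = row j (second_form_at f p i).
Proof.
move=> /(isometric_on_chart_at p)[U [[mG mG' sF UU' _] Ux Fx]]; have [oU _ _ _] := mG.
rewrite /sff_basis /sff_coord /second_form_at /second_form.
rewrite jacobian_mxE; last exact: smooth_differentiable sF Ux.
rewrite connection_term_mx -(row_jacobian_mx _ j) -!row_mul.
have H (a b c : 'M[R]_(n, m)) : row j (a + b - c) = row j a + row j b - row j c.
  by rewrite linearB linearD.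
apply: etrans _ (esym (H _ _ _)); congr (_ + _ - _).
exact: esym (row_pd_jacobian_mx i j oU sF Ux).
Qed.

Lemma shapeE (R : realType) n m (N : riemannian R n)
  (M : riemannian R m) (f : N -> M) (p : N) (xi : tangent (f p)) (X : tangent p) :
  isometric_immersion f ->
  Defs.shape xi X = X *m normal_form xi *m invmx (metric_at p).
Proof.
move=> iso; congr (_ *m _); apply/rowP => j; rewrite [LHS]mxE [RHS]mxE.
rewrite /dotp /sff inner_sum; apply: eq_bigr => i _.
rewrite inner_sum (bigD1 j) //= big1 ?addr0 => [|k kj].
  by rewrite mxE !eqxx mulr1 innerZl sff_basisE // [in RHS]mxE.
by rewrite mxE (negPf kj) andbF mulr0 scale0r /inner !mul0mx mxE.
Qed.

Lemma mean_curvatureE (R : realType) n m (N : riemannian R n)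
  (M : riemannian R m) (f : N -> M) (p : N) (xi : tangent (f p)) :
  isometric_immersion f ->
  (forall i k, row k (second_form_at f p i) = normal_form xi i k *: xi) ->
  (normal_form xi)^T = normal_form xi ->
  mean_curvature f p =
  (n%:R^-1 * \tr (normal_form xi *m invmx (metric_at p))) *: xi.
Proof.
move=> iso nE sb; rewrite /mean_curvature -scalerA; congr (_ *: _).
rewrite mxtrace_mulC /mxtrace scaler_suml; apply: eq_bigr => i _.
rewrite mxE scaler_suml; apply: eq_bigr => j _.
have -> : normal_form xi j i = normal_form xi i j by rewrite -{1}sb mxE.
by rewrite sff_basisE // nE scalerA.
Qed.

Lemma unit_normal_mx (R : realType) n m (N : riemannian R n)
  (M : riemannian R m) (f : N -> M) (p : N) (xi : tangent (f p)) :
  isometric_immersion f -> unit_normal xi ->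
  inner (metric_at (f p)) xi xi = 1 /\
  xi *m metric_at (f p) *m ('J (local_expr f p) (chart_at p p))^T = 0.
Proof.
move=> iso [xi1 xi0]; split => //; apply/rowP => i; rewrite -inner_row [RHS]mxE.
by rewrite rowE; exact: xi0.
Qed.

Lemma hypersurface_at (R : realType) (h : nat) (c : R)
  (M : kahler R h.+1) (N : riemannian R h.*2.+1) (f : N -> M) (p : N)
  (xi : tangent (f p)) :
  constant_holomorphic_curvature M (4 * c) ->
  isometric_immersion f -> unit_normal xi ->
  let Y := Jnormal xi in
  let G := metric_at p in
  let b := normal_form xi in
  let v := Y *m b in
  [/\ (forall i k, row k (second_form_at f p i) = b i k *: xi), inner G Y Y = 1,
      b^T = b &
   Ric Y Y = 2 * h%:R * c + \tr (b *m invmx G) * (v *m Y^T) 0 0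
    - (v *m invmx G *m v^T) 0 0].
Proof.
move=> hol iso nxi Y G b v; have [xi1 xi0] := unit_normal_mx iso nxi.
have [U [isoU Ux Fx]] := isometric_on_chart_at p iso.
have [mG mG' sF UU' GE] := isoU.
have JE := jacobian_mxE (smooth_differentiable sF Ux).
have fa := chart_at_atlas (f p); have fd := chart_at_dom (f p).
have JJ := cplx_sqr fa fd.
have JG := cplx_orthogonal fa fd.
have U'x : (chart_at (f p) @` cdom (chart_at (f p))) (chart_at (f p) (f p)).
  by exists (f p).
have [] := @space_form_curvature R _ _ _ (cplx (chart_at (f p))) c _ mG'
  (cplx_smooth fa) _ U'x (@metric_at_pos R _ M (f p)) JJ JG.
- by move=> _ k [q aq <-]; exact: (cplx_parallel fa aq).
- by move=> X X0; apply: (hol (f p) X); exact/eqP.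
move=> cl hc.
have uG : G \in unitmx by apply: posdef_unitmx; exact: metric_at_pos.
have GD : G = 'J (local_expr f p) (chart_at p p) *m metric_at (f p)
    *m ('J (local_expr f p) (chart_at p p))^T.
  by rewrite JE; have := GE _ Ux; rewrite Fx.
(* J xi is tangent: its difference [w] from its tangential projection is normal, hence a multiple of
   xi, and the coefficient <w, xi> is zero because <J xi, xi> = 0. *)
have YD : Y *m 'J (local_expr f p) (chart_at p p) = Jmap xi.
  apply/esym/eqP; rewrite -subr_eq0; apply/eqP.
  have sg : (metric_at (f p))^T = metric_at (f p) := metric_at_sym (f p).
  set D := 'J (local_expr f p) (chart_at p p); set w := Jmap xi - Y *m D.
  have w0 : w *m metric_at (f p) *m D^T = 0.
    rewrite /w !mulmxBl -(mulmxA Y) -(mulmxA Y) -GD.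
    by rewrite mulmxKV // subrr.
  have uD : D *m metric_at (f p) *m D^T \in unitmx by rewrite -GD.
  (* The ambient dimension [h.+1.*2] computes to [h.*2.+2], so codimension one holds by
     conversion. *)
  rewrite (@normal_line R h.*2.+1 D (metric_at (f p)) xi w uD xi1 xi0 w0).
  suff -> : inner (metric_at (f p)) w xi = 0 by rewrite scale0r.
  rewrite /w -scaleN1r innerDl innerZl innerC // inner_complex_orthogonal // innerC //.
  by rewrite /inner trmx_mul !mulmxA xi0 mul0mx mxE mulr0 addr0.
have := @hypersurface_ricci R h.*2.+1 U (metric (chart_at p)) _
  (metric (chart_at (f p))) (local_expr f p) (chart_at p p) xi
  (cplx (chart_at (f p)) (chart_at (f p) (f p))) Y c isoU Ux.
rewrite Fx -JE => /(_ cl hc JJ JG xi1 xi0 YD)[nE Y1 sb ric].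
split=> //; apply: etrans ric _; congr (_ + _ - _).
by rewrite -addn1 natrD addrK -mul2n natrM mulrC.
Qed.

(** Carries information about the chosen normal to every unit normal over which [hopf] and
    [special_hopf] quantify. *)
Lemma unit_normal_unique (R : realType) (h : nat)
  (M : kahler R h.+1) (N : riemannian R h.*2.+1) (f : N -> M) (p : N)
  (xi xi' : tangent (f p)) :
  isometric_immersion f -> unit_normal xi -> unit_normal xi' ->
  exists s : R, xi' = s *: (xi : 'rV[R]_h.+1.*2) :> 'rV[R]_h.+1.*2.
Proof.
move=> iso nxi nxi'; have [xi1 xi0] := unit_normal_mx iso nxi.
have [_ xi'0] := unit_normal_mx iso nxi'.
exists (inner (metric_at (f p)) xi' xi).
apply: (@normal_line R h.*2.+1 ('J (local_expr f p) (chart_at p p))) => //.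
have [U [[_ _ sF _ GE] Ux Fx]] := isometric_on_chart_at p iso.
have JE := jacobian_mxE (smooth_differentiable sF Ux).
have := GE _ Ux; rewrite Fx -JE => <-.
by apply: posdef_unitmx; exact: metric_at_pos.
Qed.

Lemma JnormalZ (R : realType) (n m : nat) (M : kahler R m) (N : riemannian R n)
  (f : N -> M) (p : N) (xi : tangent (f p)) (s : R) :
  Jnormal (f := f) (s *: (xi : 'rV[R]_m.*2) : tangent (f p)) =
  s *: (Jnormal xi : 'rV[R]_n).
Proof. by rewrite /Jnormal /tangential /Jmap -!scalemxAl. Qed.

Lemma normal_formZ (R : realType) n m (N : riemannian R n)
  (M : riemannian R m) (f : N -> M) (p : N) (xi : tangent (f p)) (s : R) :
  normal_form (f := f) (s *: (xi : 'rV[R]_m) : tangent (f p)) = s *: normal_form xi.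
Proof. by apply/matrixP => i j; rewrite !mxE innerZr. Qed.

Theorem theorem6p1 (R : realType) (h : nat) (c : R)
  (M : kahler R h.+1) (N : riemannian R h.*2.+1) (f : N -> M)
  (xi : forall p : N, tangent (f p)) :
  (1 <= h)%N ->
  complex_space_form M (4 * c) ->
  isometric_immersion f ->
  (forall p : N, unit_normal (xi p)) ->
  (forall p : N,
     Ric (Jnormal (xi p)) (Jnormal (xi p)) <=
       (2 * h%:R + 1) ^+ 2 / 2 * mean_curvature_sqr f p + 2 * h%:R * c) /\
  ((forall p : N,
     Ric (Jnormal (xi p)) (Jnormal (xi p)) =
       (2 * h%:R + 1) ^+ 2 / 2 * mean_curvature_sqr f p + 2 * h%:R * c) <->
   minimal f /\ special_hopf f).
Proof.
move=> _ [_ _ hol] iso nxi.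
(* With Y = J xi and A the shape operator: [t] is tr A, [v] the covector <AY, .>, [a] is <AY,Y> and
   [z] is AY - aY. *)
pose t p := \tr (normal_form (xi p) *m invmx (metric_at p)).
pose v p : 'rV[R]_h.*2.+1 := Jnormal (xi p) *m normal_form (xi p).
pose a p := (v p *m (Jnormal (xi p))^T) 0 0.
pose z p := v p *m invmx (metric_at p) - a p *: (Jnormal (xi p) : 'rV[R]_h.*2.+1).
have n0 : (2 * h%:R + 1 : R) != 0 by rewrite gt_eqF // ltr_wpDl // mulr_ge0.
have nE : (h.*2.+1)%:R = 2 * h%:R + 1 :> R by rewrite -addn1 natrD -mul2n natrM.
have meanE p : mean_curvature f p = ((2 * h%:R + 1)^-1 * t p) *: xi p :> 'rV[R]_h.+1.*2.
  have [rE _ sb _] := hypersurface_at hol iso (nxi p).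
  by rewrite (mean_curvatureE iso rE sb) nE.
have defect p : (2 * h%:R + 1) ^+ 2 / 2 * mean_curvature_sqr f p + 2 * h%:R * c
    - Ric (Jnormal (xi p)) (Jnormal (xi p)) =
    ((t p - a p) ^+ 2 + a p ^+ 2) / 2 + inner (metric_at p) (z p) (z p).
  have [_ Y1 _ ->] := hypersurface_at hol iso (nxi p).
  have [xi1 _] := nxi p.
  rewrite /mean_curvature_sqr /dotp meanE innerZl innerZr [inner _ _ _]xi1.
  rewrite -(@normal_ricci_defect _ _ _ _ (v p) (t p) (a p) (metric_at_sym p) _ Y1 erefl).
    by rewrite /a /t /v; field.
  by apply: posdef_unitmx; exact: metric_at_pos.
have inner_ge0 p u : 0 <= inner (metric_at (p : N)) u u.
  have [->|u0] := eqVneq u 0; first by rewrite /inner mul0mx mul0mx mxE.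
  by rewrite ltW // metric_at_pos.
have inner_eq0 p u : inner (metric_at (p : N)) u u = 0 -> u = 0.
  by move=> u0; apply/eqP; apply: contraT => /(metric_at_pos p); rewrite u0 ltxx.
split=> [p|].
  rewrite -subr_ge0 defect; have := inner_ge0 p (z p).
  have := sqr_ge0 (t p - a p); have := sqr_ge0 (a p); lra.
split=> [eqR|[minf [_ spf]] p].
  (* Equality annihilates each nonnegative term of the defect: a = 0, then t = a = 0, and z = 0
     becomes AY = 0. *)
  have tav p : t p = 0 /\ v p *m invmx (metric_at p) = 0.
    have := defect p; rewrite eqR subrr.
    have := inner_ge0 p (z p); have := sqr_ge0 (t p - a p); have := sqr_ge0 (a p).
    move=> a2 ta2 z2 E.
    have z0 : inner (metric_at p) (z p) (z p) = 0 by lra.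
    have /eqP : a p ^+ 2 = 0 by lra.
    rewrite sqrf_eq0 => /eqP a0; have /eqP : (t p - a p) ^+ 2 = 0 by lra.
    rewrite sqrf_eq0 a0 subr0 => /eqP t0; split => //.
    by have := inner_eq0 _ _ z0; rewrite /z a0 scale0r subr0.
  have sh p (xi' : tangent (f p)) : unit_normal xi' ->
      Defs.shape xi' (Jnormal xi') = 0 :> 'rV[R]_h.*2.+1.
    (* A_xi (J xi) is quadratic in xi, so a multiple s xi only introduces the factor s^2. *)
    move=> nxi'; have [s ->] := unit_normal_unique iso (nxi p) nxi'.
    rewrite shapeE // JnormalZ normal_formZ -!scalemxAl -scalemxAr -!scalemxAl.
    by have [_ ->] := tav p; rewrite !scaler0.
  split; first by move=> p; rewrite meanE (tav p).1 mulr0 scale0r.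
  split=> [p xi' nxi'|//]; exists 0; rewrite scale0r; exact: sh.
apply/eqP; rewrite eq_sym -subr_eq0 defect; apply/eqP.
(* H is (t / n) xi and xi is nonzero, being a unit vector, so minimality gives t = 0. *)
have t0 : t p = 0.
  have := meanE p; rewrite minf => /esym/eqP; rewrite scaler_eq0 mulf_eq0 invr_eq0.
  rewrite (negPf n0) /= => /orP[/eqP //|/eqP x0].
  by have [+ _] := nxi p; rewrite x0 /dotp /inner !mul0mx mxE => /eqP; rewrite eq_sym oner_eq0.
have v0 : v p = 0.
  have := spf p _ (nxi p); rewrite shapeE // => /(congr1 (mulmx^~ (metric_at p))).
  rewrite mul0mx mulmxKV //.
  by apply: posdef_unitmx; exact: metric_at_pos.
have a0 : a p = 0 by rewrite /a v0 mul0mx mxE.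
have z0 : z p = 0 by rewrite /z a0 v0 [X in X - _]mul0mx scale0r subr0.
by rewrite z0 t0 a0 /inner !mul0mx mxE; ring.
Qed.
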